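(* For every partition $\lambda$ of $n$ there is an isomorphism of left $RS_n$-modules $\operatorname{Ind}(\lambda)\cong C(\lambda)$.
   Context: $R$ is the localization of $\mathbb Z$ at a prime $(p)$. Jucys–Murphy elements $L_1=0$, $L_k=\sum_{j<k}(j,k)$. $\operatorname{GZ}_n$ is the (commutative) $R$-subalgebra of $RS_n$ generated by $L_1,\dots,L_n$. Content $r_t(k)=j-i$ if $k$ is in node $[i,j]$; $t^\lambda$ is the $\lambda$-tableau with $1,\dots,n$ along rows; $r_\lambda(i):=r_{t^\lambda}(i)$. $I_\lambda$ is the ideal of $\operatorname{GZ}_n$ generated by $L_i-r_\lambda(i)$, $i=1,\dots,n$, and $1_\lambda:=\operatorname{GZ}_n/I_\lambda$. For a finitely generated $R$-module $M$, $M^*:=\operatorname{Hom}_R(M,R)$ and $\operatorname{Fr}(M):=M^{**}$ ($\cong M/\operatorname{Tor}(M)$). For a finitely generated $\operatorname{GZ}_n$-module $M$, $\operatorname{Ind}(M):=\operatorname{Fr}(RS_n\otimes_{\operatorname{GZ}_n}M)$, and $\operatorname{Ind}(\lambda):=\operatorname{Ind}(1_\lambda)$. Murphy basis: $S_\lambda$ row stabilizer of $t^\lambda$, $x_\lambda=\sum_{\sigma\in S_\lambda}\sigma$, $d(t)$ defined by $t^\lambda d(t)=t$ (right action), $x_{st}=d(s)^{-1}x_\lambda d(t)$; $\{x_{st}\}$, with $s,t$ standard of the same shape, is an $R$-basis of $RS_n$. $RS_n^{\rhd\lambda}$ is the $R$-span of the $x_{uv}$ with $u,v$ standard $\mu$-tableaux,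 $\mu\rhd\lambda$ (dominance order); it is a two-sided ideal. The cell module $C(\lambda)$ is the left $RS_n$-module $(RS_nx_\lambda+RS_n^{\rhd\lambda})/RS_n^{\rhd\lambda}$, free over $R$ with basis the images of $x_{s t^\lambda}$, $s$ standard $\lambda$-tableau. *)

(* Defs.v *)
From HB Require Import structures.
From mathcomp Require Import all_boot all_order all_algebra all_fingroup.
Set Implicit Arguments. Unset Strict Implicit. Unset Printing Implicit Defensive.
Import Order.TTheory GRing.Theory Num.Theory.
Local Open Scope ring_scope.

Definition zloc (p : nat) : {pred rat} := fun x => coprime `|denq x|%N p.

Lemma denq_dvd_int (x : rat) (d : int) :
  x * d%:~R \is a Num.int -> (denq x %| d)%Z.
Proof.
move=> /intrP[z Hz].
have E : numq x * d = z * denq x.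
  apply: (@intr_inj rat); rewrite !intrM numqE -Hz; by rewrite mulrAC.
have : (denq x %| numq x * d)%Z by rewrite E dvdz_mull.
rewrite Gauss_dvdzr //.
by rewrite coprimezE coprime_sym coprime_num_den.
Qed.

Lemma zloc_dvd p (x : rat) (d : int) :
  coprime `|d|%N p -> x * d%:~R \is a Num.int -> x \in zloc p.
Proof.
move=> cd /denq_dvd_int; rewrite dvdzE => dv.
by rewrite unfold_in /zloc (coprime_dvdl dv).
Qed.

Fact zloc_subring p : subring_closed (zloc p).
Proof.
split.
- by rewrite unfold_in /zloc coprime1n.
- move=> x y Hx Hy; apply: (@zloc_dvd p _ (denq x * denq y)).
    by rewrite abszM coprimeMl; apply/andP.
  rewrite mulrBl intrM mulrA -numqE.
  rewrite (mulrC (denq x)%:~R) mulrA -numqE.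
  by rewrite -!intrM -intrB intr_int.
- move=> x y Hx Hy; apply: (@zloc_dvd p _ (denq x * denq y)).
    by rewrite abszM coprimeMl; apply/andP.
  by rewrite intrM mulrACA -!numqE -intrM intr_int.
Qed.

HB.instance Definition _ p := GRing.isSubringClosed.Build rat (zloc p) (zloc_subring p).

Record Zloc (p : nat) := ZLoc { zval : rat; zvalP : zval \in zloc p }.
HB.instance Definition _ p := [isSub for @zval p].
HB.instance Definition _ p := [Choice of Zloc p by <:].
HB.instance Definition _ p := [SubChoice_isSubComNzRing of Zloc p by <:].


(* The group algebra R S_n.  Elements are finitely supported functions       *)
(* S_n -> R (i.e. all functions, S_n being finite); the product is the       *)
(* convolution for the group law of {perm 'I_n}.  MathComp's permutation     *)
(* product satisfies (s * t) i = t (s i), i.e. permutations act on the right  *)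
(* of 'I_n (i . s := s i), which is the convention of the paper.             *)
(* NB: the ring structure of {ffun _ -> _} in MathComp is POINTWISE; we      *)
(* never use it: the group-algebra product is [gmul].                        *)
Unset Implicit Arguments.

Definition RS (p n : nat) := {ffun {perm 'I_n} -> (Zloc p)^o}.

Definition gelt (p n : nat) (s : {perm 'I_n}) : RS p n :=
  [ffun h => ((h == s)%:R : (Zloc p)^o)].

Definition gmul (p n : nat) (a b : RS p n) : RS p n :=
  [ffun g => \sum_(h : {perm 'I_n}) a h * b (h^-1 * g)%g].

Definition gone (p n : nat) : RS p n := gelt p n 1%g.

(* The Jucys--Murphy element L_k = sum_{j<k} (j,k).  The points 1..n of the  *)
(* paper are 0..n-1 here (index shift by one), so L_{k+1} = JM k.            *)
Definition JM (p n : nat) (k : 'I_n) : RS p n :=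
  \sum_(j : 'I_n | (j < k)%N) gelt p n (tperm j k).

Definition is_partition (n : nat) (l : seq nat) : bool :=
  [&& sorted geq l, all (fun x => 0 < x)%N l & sumn l == n].

(* rowcol l k = (i, j) (0-based row and column) is the node of the entry k   *)
(* (0-based) in the row-reading tableau t^lambda, which has 0,...,n-1 filled  *)
(* along the rows.  (Paper: entry k+1 is in node [i+1, j+1].)                *)
Fixpoint rowcol (l : seq nat) (k : nat) : nat * nat :=
  if l is a :: l' then
    (if (k < a)%N then (0%N, k)
     else let rc := rowcol l' (k - a) in (rc.1.+1, rc.2))
  else (0%N, k).

Definition content (l : seq nat) (k : nat) : int :=
  (rowcol l k).2%:Z - (rowcol l k).1%:Z.

(* A lambda-tableau t is determined by the permutation d(t) with             *)
(* t^lambda d(t) = t (right action): the entry of t in the node of the       *)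
(* entry k of t^lambda is k . d(t) = d(t) k.  We therefore represent the     *)
(* tableau t by d = d(t) : {perm 'I_n}.  It is standard iff entries increase *)
(* along rows (node (i,j) -> (i,j+1)) and down columns ((i,j) -> (i+1,j)).   *)
Definition is_standard (l : seq nat) (n : nat) (d : {perm 'I_n}) : bool :=
  [forall k : 'I_n, forall k' : 'I_n,
     ((((rowcol l k').1 == (rowcol l k).1) && ((rowcol l k').2 == (rowcol l k).2.+1))
      || (((rowcol l k').1 == (rowcol l k).1.+1) && ((rowcol l k').2 == (rowcol l k).2)))
     ==> (d k < d k')%N].

Definition row_stab (l : seq nat) (n : nat) : {set {perm 'I_n}} :=
  [set s : {perm 'I_n} | [forall k : 'I_n, (rowcol l (s k)).1 == (rowcol l k).1]].

Definition xlam (p n : nat) (l : seq nat) : RS p n :=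
  \sum_(s in row_stab l n) gelt p n s.

Definition murphy (p n : nat) (l : seq nat) (ds dt : {perm 'I_n}) : RS p n :=
  gmul p n (gmul p n (gelt p n ds^-1) (xlam p n l)) (gelt p n dt).

(* dominance order: mu dominates lambda iff all partial sums of mu are >=    *)
(* those of lambda (partial sums are constant beyond both lengths, so the    *)
(* bounded quantification is equivalent to quantifying over all k).          *)
Definition dominates (m l : seq nat) : bool :=
  [forall k : 'I_(size m + size l).+1, (sumn (take k l) <= sumn (take k m))%N].

Definition sdominates (m l : seq nat) : bool := dominates m l && (m != l).

Definition RSdom (p n : nat) (l : seq nat) (y : RS p n) : Prop :=
  exists c : seq (Zloc p * (seq nat * ({perm 'I_n} * {perm 'I_n}))),
    all (fun x => [&& is_partition n x.2.1, sdominates x.2.1 l,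
                      is_standard x.2.1 n x.2.2.1 & is_standard x.2.1 n x.2.2.2]) c
    /\ y = \sum_(x <- c) x.1 *: murphy p n x.2.1 x.2.2.1 x.2.2.2.

(* The cell module C(lambda) = (R S_n x_lambda + R S_n^{|>lambda}) /         *)
(* R S_n^{|>lambda}: its numerator submodule is [cell_num]; its              *)
(* denominator is [RSdom].                                                   *)
Definition cell_num (p n : nat) (l : seq nat) (y : RS p n) : Prop :=
  exists a b : RS p n, RSdom p n l b /\ y = gmul p n a (xlam p n l) + b.

Definition jm_monomial (p n : nat) (s : seq 'I_n) : RS p n :=
  foldr (gmul p n) (gone p n) (map (JM p n) s).

(* GZ_n: the R-subalgebra of R S_n generated by L_1, ..., L_n, i.e. the      *)
(* R-span of the monomials in the L_k.                                       *)
Definition in_GZ (p n : nat) (g : RS p n) : Prop :=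
  exists c : seq (Zloc p * seq 'I_n), g = \sum_(x <- c) x.1 *: jm_monomial p n x.2.

Definition in_Ilam (p n : nat) (l : seq nat) (g : RS p n) : Prop :=
  exists gs : 'I_n -> RS p n, (forall i, in_GZ p n (gs i)) /\
    g = \sum_(i < n) gmul p n (gs i) (JM p n i - (content l i)%:~R *: gone p n).

(* RS_n . I_lambda, the left ideal of R S_n generated by I_lambda.  We have  *)
(* RS_n (x)_{GZ_n} 1_lambda = RS_n (x)_{GZ_n} GZ_n/I_lambda                  *)
(*   ~= RS_n / (RS_n . I_lambda)  as left RS_n-modules.                      *)
Definition in_RSIlam (p n : nat) (l : seq nat) (y : RS p n) : Prop :=
  exists c : seq (RS p n * RS p n), (forall x, x \in c -> in_Ilam p n l x.2) /\
    y = \sum_(x <- c) gmul p n x.1 x.2.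

(* Ind(lambda) = Fr(RS_n / RS_n . I_lambda) = (RS_n / K) / Tor(RS_n / K)     *)
(*   = RS_n / K^sat, with K = RS_n . I_lambda and                            *)
(* K^sat = {x | r x in K for some nonzero r in R}.                           *)
Definition Ind_ker (p n : nat) (l : seq nat) (y : RS p n) : Prop :=
  exists2 r : Zloc p, r != 0 & in_RSIlam p n l (r *: y).

(* Isomorphism of subquotients of R S_n as left R S_n-modules.               *)
(* For left submodules N <= M and N' <= M' of R S_n (given as predicates),   *)
(* quot_iso M N M' N' says that there is an isomorphism of left R S_n-       *)
(* modules M/N ~= M'/N', presented on representatives by f : RS -> RS:       *)
(* f maps M into M' and N into N', is R S_n-linear modulo N', and the        *)
(* induced map M/N -> M'/N' is injective and surjective.  (R-linearity is    *)
(* included, since r . x = (r 1) x.)                                         *)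
Definition quot_iso (p n : nat) (M N M' N' : RS p n -> Prop) : Prop :=
  exists f : RS p n -> RS p n,
    [/\ forall x, M x -> M' (f x),
        forall x, N x -> N' (f x),
        forall a x y, M x -> M y ->
          N' (f (gmul p n a x + y) - (gmul p n a (f x) + f y)),
        forall x, M x -> N' (f x) -> N x
      & forall y, M' y -> exists2 x, M x & N' (f x - y)].

(* Main.v *)
Require Import Defs.
From HB Require Import structures.
From mathcomp Require Import all_boot all_order all_algebra all_fingroup.
From mathcomp Require Import zify ring lra.
Import Order.TTheory GRing.Theory Num.Theory.
Local Open Scope ring_scope.
Set Implicit Arguments. Unset Strict Implicit. Unset Printing Implicit Defensive.

(** The isomorphism is induced by right multiplication by [x_lambda].

    It is well defined because [L_i x_lambda] is [r_lambda(i) x_lambda] modulo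
    the larger shapes: [1 + sum_j (j,i)], [j] running over a row above [i],
    turns [x_lambda] into a multiple of the symmetrizer of the composition
    obtained by moving [i] up to that row.  The span of the Murphy elements of
    larger shape is a left ideal by straightening, and it is pure because those
    elements are unitriangular against the pairing
    [(a, (u,v)) |-> coefficient of 1 in a d(v)^-1 kappa_lambda d(u)].

    For injectivity let [v] be the class of [1] in [Ind(lambda)].  The sum of
    all [L_i] is the sum of all transpositions, hence central; it acts on
    [R S_n v] by the content sum of [lambda], and on a vector [x_mu h v] killed
    by the shapes above [mu] by the content sum of [mu].  As content sums are
    strictly monotone for dominance, [x_mu h v = 0] for every [mu] larger than
    [lambda].  Applied to the shapes of the initial segments of [t^lambda], the
    same fact gives [x_lambda v = K v] with [K > 0], by induction on [n].  So
    [y x_lambda = 0] in [C(lambda)] implies [K y v = 0], hence [y v = 0]. *)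

(** * Partitions and nodes *)

Lemma sumn_take_le m (l : seq nat) : (sumn (take m l) <= sumn l)%N.
Proof. by rewrite -{2}(cat_take_drop m l) sumn_cat leq_addr. Qed.

Lemma sumn_takeS m (l : seq nat) :
  sumn (take m.+1 l) = (sumn (take m l) + nth 0 l m)%N.
Proof.
elim: l m => [|a l IH] [|m] //=; first by rewrite take0 addn0.
by rewrite IH addnA.
Qed.

Lemma rowcol_ltn (l : seq nat) k : (k < sumn l)%N ->
  ((rowcol l k).2 < nth 0 l (rowcol l k).1)%N.
Proof.
elim: l k => [|a l IH] k //= kl.
by case: (ltnP k a) => //= ak; apply: IH; lia.
Qed.

Lemma rowcol_pos (l : seq nat) k :
  k = (sumn (take (rowcol l k).1 l) + (rowcol l k).2)%N.
Proof.
elim: l k => [|a l IH] k //=.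
by case: (ltnP k a) => //= ak; rewrite -addnA -IH subnKC.
Qed.

Lemma rowcol_inj (l : seq nat) k k' : rowcol l k = rowcol l k' -> k = k'.
Proof. by move=> E; rewrite (rowcol_pos l k) (rowcol_pos l k') E. Qed.

Lemma rowcol_node (l : seq nat) i j : (j < nth 0 l i)%N ->
  rowcol l (sumn (take i l) + j) = (i, j).
Proof.
elim: l i => [|a l IH] [|i] //=; first by move=> ->.
move=> jl; have -> : (a + sumn (take i l) + j < a)%N = false by lia.
by rewrite -addnA addKn IH.
Qed.

Lemma node_ltn (l : seq nat) i j : (j < nth 0 l i)%N ->
  (sumn (take i l) + j < sumn l)%N.
Proof.
move=> jl; have := sumn_take_le i.+1 l; rewrite sumn_takeS; lia.
Qed.

Lemma rowcol_row_ltn (l : seq nat) k m : (k < sumn l)%N ->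
  ((rowcol l k).1 < m)%N = (k < sumn (take m l))%N.
Proof.
elim: l k m => [|a l IH] k [|m] //= kl.
case: (ltnP k a) => [ka|ak] /=; first by rewrite ltn_addr.
by rewrite ltnS IH; lia.
Qed.

Lemma rowcol_rcons (l : seq nat) a k : (k < sumn l + a)%N ->
  rowcol (rcons l a) k = rowcol l k.
Proof.
elim: l k => [|b l IH] k /=; first by move=> ->.
by move=> kl; case: (ltnP k b) => // bk; rewrite IH //; lia.
Qed.

Lemma partition_sumn n l : is_partition n l -> sumn l = n.
Proof. by case/and3P => _ _ /eqP. Qed.

Lemma partition_nth n l i j : is_partition n l -> (i <= j)%N ->
  (nth 0 l j <= nth 0 l i)%N.
Proof.
case/and3P => s _ _ ij.
case: (ltnP j (size l)) => jl; last by rewrite (nth_default _ jl).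
have := @sorted_leq_nth nat geq (rev_trans leq_trans) leqnn 0%N l s.
by apply => //; rewrite inE; lia.
Qed.

Lemma partition_nth_gt0 n l i : is_partition n l -> (i < size l)%N ->
  (0 < nth 0 l i)%N.
Proof. by case/and3P => _ /all_nthP P _ /P; apply. Qed.

Lemma dominates_sumn n m l : is_partition n m -> is_partition n l ->
  dominates m l -> forall k, (sumn (take k l) <= sumn (take k m))%N.
Proof.
move=> /partition_sumn Em /partition_sumn El /forallP H k.
case: (ltnP k (size m + size l).+1) => kl; first by have := H (Ordinal kl).
by rewrite !take_oversize ?Em ?El //; lia.
Qed.

Lemma partition_eq n m l : is_partition n m -> is_partition n l ->
  (forall k, sumn (take k l) = sumn (take k m)) -> m = l.
Proof.
move=> Pm Pl H.
have E i : nth 0%N m i = nth 0%N l i.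
  by have := H i.+1; rewrite !sumn_takeS H => /addnI ->.
apply: (@eq_from_nth _ 0%N) => //.
apply/eqP; rewrite eqn_leq; apply/andP; split; rewrite leqNgt; apply/negP => lt.
  by have := partition_nth_gt0 Pm lt; rewrite E nth_default.
by have := partition_nth_gt0 Pl lt; rewrite -E nth_default.
Qed.

Lemma sdominates_sumnP n m l : is_partition n m -> is_partition n l ->
  reflect ((forall k, (sumn (take k l) <= sumn (take k m))%N)
           /\ exists k, (sumn (take k l) < sumn (take k m))%N)
          (sdominates m l).
Proof.
move=> Pm Pl; apply: (iffP andP) => [[D ne]|[D [k lt]]].
  have D' := dominates_sumn Pm Pl D; split => //.
  have /forallPn [k lt] :
    ~~ [forall k : 'I_(size m + size l).+1, sumn (take k m) <= sumn (take k l)]%N.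
    apply: contraNN ne => /forallP H; apply/eqP.
    apply: (partition_eq Pm Pl) => k; apply/eqP; rewrite eqn_leq D' /=.
    case: (ltnP k (size m + size l).+1) => kl; first by have := H (Ordinal kl).
    by rewrite !take_oversize ?(partition_sumn Pm) ?(partition_sumn Pl) //; lia.
  by exists k; rewrite ltnNge.
split; first by apply/forallP => ?.
by apply: contraTneq lt => ->; rewrite ltnn.
Qed.

Lemma sdominates_trans n a b c : is_partition n a -> is_partition n b ->
  is_partition n c -> sdominates a b -> sdominates b c -> sdominates a c.
Proof.
move=> Pa Pb Pc /(sdominates_sumnP Pa Pb)[ab [k lt]] /(sdominates_sumnP Pb Pc)[bc _].
apply/(sdominates_sumnP Pa Pc); split=> [i|]; first exact: leq_trans (bc i) (ab i).
by exists k; apply: leq_ltn_trans (bc k) lt.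
Qed.

(** Induction from the top of the dominance order: going up strictly raises the sum of the first [n]
    partial sums, which is bounded by [n * n]. *)
Lemma sdominates_ind n (P : seq nat -> Prop) :
  (forall m, is_partition n m ->
     (forall m', is_partition n m' -> sdominates m' m -> P m') -> P m) ->
  forall m, is_partition n m -> P m.
Proof.
move=> H m; have [N le] := ubnP (n * n - \sum_(k < n) sumn (take k m)).
elim: N m le => // N IH m le Pm; apply: H => // m' Pm' D.
apply: IH => //; apply: leq_trans (_ : n * n - \sum_(k < n) sumn (take k m) <= N)%N; last by [].
case/(sdominates_sumnP Pm' Pm): D => D [k lt].
(* Partitions of [n] have at most [n] parts, so the partial sums agree from [n] on and the strict
   inequality occurs earlier. *)
have kn : (k < n)%N.
  have szl x : is_partition n x -> (size x <= n)%N.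
    move=> Px; rewrite -(partition_sumn Px).
    case/and3P: Px => _ + _; elim: x {lt D m le Pm Pm'} => //= a x IHx /andP[a0 /IHx]; lia.
  rewrite ltnNge; apply/negP => nk; move: lt.
  by rewrite !take_oversize ?(leq_trans _ nk) ?szl // (partition_sumn Pm) (partition_sumn Pm') ltnn.
have bnd x : is_partition n x -> (\sum_(k < n) sumn (take k x) <= n * n)%N.
  move=> Px; rewrite -[X in (_ <= X * _)%N]card_ord -sum_nat_const.
  by apply: leq_sum => i _; rewrite -[leqRHS](partition_sumn Px) sumn_take_le.
have := bnd _ Pm'; suff : (\sum_(k < n) sumn (take k m) < \sum_(k < n) sumn (take k m'))%N by lia.
rewrite (bigD1 (Ordinal kn)) //= [ltnRHS](bigD1 (Ordinal kn)) //=.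
by rewrite -addSn leq_add // leq_sum.
Qed.

(** * Shape of a row word *)

Definition rowf n l (k : 'I_n) : nat := (rowcol l k).1.
Definition colf n l (k : 'I_n) : nat := (rowcol l k).2.
Arguments rowf : clear implicits.
Arguments colf : clear implicits.

Lemma card_ltn n M : (M <= n)%N -> #|[set k : 'I_n | (k < M)%N]| = M.
Proof.
move=> Mn; rewrite -sum1dep_card.
by rewrite -(big_ord_widen n (fun=> 1%N) Mn) sum1_card card_ord.
Qed.

Lemma card_row_ltn n l m : is_partition n l ->
  #|[set k : 'I_n | (rowf n l k < m)%N]| = sumn (take m l).
Proof.
move=> /partition_sumn El.
have := sumn_take_le m l; rewrite El => /card_ltn <-.
by congr #|pred_of_set _|; apply/setP => k; rewrite !inE rowcol_row_ltn // El.
Qed.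

Lemma card_row_eq n l m : is_partition n l ->
  #|[set k : 'I_n | rowf n l k == m]| = nth 0%N l m.
Proof.
move=> Pl; have := sumn_takeS m l; rewrite -!(card_row_ltn _ Pl).
rewrite [#|[set k | (_ < m.+1)%N]|](_ : _ = #|[set k : 'I_n | (rowf n l k < m)%N]| +
  #|[set k : 'I_n | rowf n l k == m]|)%N; first by move/addnI.
rewrite -cardsUI [X in (_ + X)%N](_ : _ = 0%N) ?addn0.
  by congr #|pred_of_set _|; apply/setP => k; rewrite !inE; lia.
by apply/eqP; rewrite cards_eq0; apply/eqP/setP => k; rewrite !inE; lia.
Qed.

Lemma sumn_take_cons (s : seq nat) a k : path geq a s ->
  (sumn (take k s) <= sumn (take k (a :: s)))%N.
Proof.
elim: s a k => [|b s IH] a [|k] //= /andP[ba bs].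
by rewrite leq_add // (IH b).
Qed.

Lemma subseq_sumn_take (s t : seq nat) : sorted geq s -> subseq t s ->
  (sumn t <= sumn (take (size t) s))%N.
Proof.
elim: s t => [|a s IH] [|b t] //= ps.
have ss := path_sorted ps.
case: eqP => [->|_] st; first by rewrite leq_add2l IH.
have /= H := IH (b :: t) ss st.
by apply: leq_trans H _; exact: (sumn_take_cons (size t).+1 ps).
Qed.

(** Sort the distinct values of [f] by decreasing multiplicity: the multiplicities form [nu], and
    [h] lists the points block by block. The first [m] rows are the largest blocks, so they hold at
    least as many points as the at most [m] blocks with values below [m]. *)
Lemma shape_exists n (f : 'I_n -> nat) :
  exists nu (h : {perm 'I_n}),
   [/\ is_partition n nu,
       forall i j, (f i == f j) = (rowf n nu (h i) == rowf n nu (h j))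
     & forall m, (#|[set k | (f k < m)%N]| <= sumn (take m nu))%N].
Proof.
pose F a := [seq i <- enum 'I_n | f i == a].
pose cnt a := size (F a).
pose s := sort (relpre cnt geq) (undup (map f (enum 'I_n))).
have us : uniq s by rewrite sort_uniq undup_uniq.
have fs i : f i \in s by rewrite mem_sort mem_undup map_f ?mem_enum.
pose e := flatten (map F s).
have row_index s' i : uniq s' -> f i \in s' ->
    (rowcol (map cnt s') (index i (flatten (map F s')))).1 = index (f i) s'.
  elim: s' => //= a s' IH /andP[as' us'].
  rewrite inE index_cat mem_filter mem_enum andbT eq_sym.
  case: eqP => [E _|ne /= fs'].
    by rewrite index_mem mem_filter mem_enum E eqxx.
  by rewrite ltnNge leq_addr /= addKn IH.
have mem_flat s' i : (i \in flatten (map F s')) = (f i \in s').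
  elim: s' => //= a s' IH; rewrite mem_cat IH mem_filter mem_enum andbT.
  by rewrite inE.
have ue : uniq e.
  rewrite /e; elim: s us {fs e} => //= a s' IH /andP[as' us'].
  rewrite cat_uniq filter_uniq ?enum_uniq // IH // andbT; apply/hasPn => i.
  rewrite mem_flat mem_filter => fi; apply: contra as' => /andP[/eqP <- _]; by [].
have me i : i \in e by rewrite mem_flat.
have pe : perm_eq e (enum 'I_n).
  by apply: uniq_perm => [||i]; rewrite ?enum_uniq ?me ?mem_enum.
have se : size e = n by rewrite (perm_size pe) size_enum_ord.
have hlt i : (index i e < n)%N by rewrite -[ltnRHS]se index_mem.
have hinj : injective (fun i => Ordinal (hlt i)).
  move=> i j /(congr1 val) /= E.
  by rewrite -(nth_index i (me i)) -(nth_index i (me j)) E.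
have sz s' : sumn (map cnt s') = size (flatten (map F s')).
  by rewrite size_flatten /shape -map_comp.
exists (map cnt s), (perm hinj); split.
- apply/and3P; split; last by rewrite sz -/e se.
    rewrite sorted_map; apply: sort_sorted => a b; exact: leq_total.
  apply/allP => _ /mapP[a + ->]; rewrite mem_sort mem_undup => /mapP[i _ ->].
  by rewrite /cnt -has_predT; apply/hasP; exists i; rewrite // mem_filter mem_enum eqxx.
- move=> i j; rewrite /rowf !permE /= !row_index //.
  apply/idP/idP => /eqP E; apply/eqP; first by rewrite E.
  by rewrite -(nth_index 0%N (fs i)) E nth_index.
move=> m.
have -> : #|[set k | (f k < m)%N]| = sumn (map cnt (filter (gtn m) s)).
  rewrite sz cardE.
  have /perm_size <- : perm_eq [seq i <- e | (f i < m)%N] (enum [set k | (f k < m)%N]).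
    apply: uniq_perm => [||i]; rewrite ?enum_uniq ?filter_uniq //.
    by rewrite mem_filter me mem_enum inE andbT.
  rewrite /e; elim: (s) => //= a s' IH; rewrite filter_cat size_cat IH.
  case: ltnP => am /=; last first.
    rewrite [X in (size X + _)%N](_ : _ = [::]) //; apply/eqP.
    rewrite -[_ == _]negbK -has_filter; apply/hasPn => i.
    by rewrite mem_filter -leqNgt => /andP[/eqP ->].
  rewrite size_cat; congr (size _ + _)%N; apply/all_filterP/allP => i.
  by rewrite mem_filter => /andP[/eqP ->].
set t := filter _ s.
apply: (@leq_trans (sumn (take (size t) (map cnt s)))).
  rewrite -(size_map cnt t); apply: subseq_sumn_take.
    by rewrite sorted_map; apply: sort_sorted => a b; exact: leq_total.
  by apply: map_subseq; apply: filter_subseq.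
have tm : (size t <= m)%N.
  rewrite -(size_iota 0 m); apply: uniq_leq_size; first by rewrite filter_uniq.
  by move=> a; rewrite mem_filter mem_iota /= add0n => /andP[].
by rewrite -(subnKC tm) takeD sumn_cat leq_addr.
Qed.

(** * Actions of the symmetric group and row symmetrizers *)

Record gaction n (V : zmodType) := GAction {
  ga :> {perm 'I_n} -> V -> V;
  gaD : forall g, {morph ga g : x y / x + y};
  ga1 : forall x, ga 1%g x = x;
  gaM : forall g h x, ga (g * h)%g x = ga g (ga h x) }.

Lemma gaB n V (a : gaction n V) g : {morph a g : x y / x - y}.
Proof.
move=> x y; have H := gaD a g (x - y) y.
by rewrite subrK in H; rewrite H addrK.
Qed.

HB.instance Definition _ n (V : zmodType) (a : gaction n V) g :=
  GRing.isZmodMorphism.Build V V (a g) (@gaB n V a g).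

(** [N x] is read as the vanishing of [x] modulo [N], so congruences are handled without forming a
    quotient. *)
Definition subgroup_pred (V : zmodType) (N : V -> Prop) :=
  N 0 /\ forall x y, N x -> N y -> N (x - y).

Section SubgroupPred.
Variables (V : zmodType) (N : V -> Prop).
Hypothesis sN : subgroup_pred N.

Lemma sub0 : N 0. Proof. by case: sN. Qed.
Lemma subB x y : N x -> N y -> N (x - y). Proof. by case: sN => _; apply. Qed.
Lemma subN x : N x -> N (- x).
Proof. by move=> Nx; rewrite -[- x]add0r; apply: subB => //; apply: sub0. Qed.
Lemma subD x y : N x -> N y -> N (x + y).
Proof. by move=> Nx Ny; rewrite -[y]opprK; apply: subB => //; apply: subN. Qed.
Lemma sub_sum I (r : seq I) (P : pred I) F :
  (forall i, P i -> N (F i)) -> N (\sum_(i <- r | P i) F i).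
Proof. by move=> H; apply: big_ind => //; [apply: sub0|apply: subD]. Qed.
Lemma subDr x y : N y -> N (x + y) -> N x.
Proof. by move=> Ny /subB /(_ Ny); rewrite addrK. Qed.
Lemma subMn x k : N x -> N (x *+ k).
Proof. by move=> Nx; elim: k => [|k IH]; [apply: sub0|rewrite mulrS; apply: subD]. Qed.

Lemma sub_sum_blocks (T : finType) (P : pred T) (cls : T -> {set T}) (F : T -> V) :
  (forall u, u \in cls u) -> (forall u v, v \in cls u -> cls v = cls u) ->
  (forall u v, v \in cls u -> P v = P u) ->
  (forall u, P u -> N (\sum_(v in cls u) F v)) ->
  N (\sum_(u | P u) F u).
Proof.
move=> cl clE PE H; rewrite (partition_big cls predT) //=.
apply: sub_sum => C _.
case: (pickP [pred u | P u && (cls u == C)]) => [u /andP[Pu /eqP <-]|none].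
  rewrite (eq_bigl (fun v => v \in cls u)); first exact: H.
  move=> v; apply/andP/idP => [[_ /eqP <-]//|vu].
  by rewrite (PE _ _ vu) (clE _ _ vu).
rewrite big_pred0; [exact: sub0|exact: none].
Qed.
End SubgroupPred.

Definition stab n (f : 'I_n -> nat) : {set {perm 'I_n}} :=
  [set g : {perm 'I_n} | [forall k, f (g k) == f k]].

Lemma stabP n (f : 'I_n -> nat) (g : {perm 'I_n}) :
  reflect (forall k, f (g k) = f k) (g \in stab f).
Proof. by rewrite inE; apply: (iffP forallP) => H k; apply/eqP. Qed.

Lemma stab1 n (f : 'I_n -> nat) : 1%g \in stab f.
Proof. by apply/stabP => k; rewrite perm1. Qed.

Lemma stabM n (f : 'I_n -> nat) g h : g \in stab f -> h \in stab f -> (g * h)%g \in stab f.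
Proof. by move=> /stabP Hg /stabP Hh; apply/stabP => k; rewrite permM Hh. Qed.

Lemma stabV n (f : 'I_n -> nat) g : g \in stab f -> (g^-1)%g \in stab f.
Proof. by move=> /stabP Hg; apply/stabP => k; rewrite -{2}(permKV g k) Hg. Qed.

Lemma card_perm_set n (g : {perm 'I_n}) (P : pred 'I_n) :
  #|[set k | P (g k)]| = #|[set k | P k]|.
Proof.
rewrite -(card_preimset [set k | P k] (@perm_inj _ g)).
by congr #|pred_of_set _|; apply/setP => k; rewrite !inE.
Qed.

Definition symm n V (a : gaction n V) (f : 'I_n -> nat) w := \sum_(g in stab f) a g w.
Definition jm n V (a : gaction n V) (i : 'I_n) w := \sum_(j : 'I_n | (j < i)%N) a (tperm j i) w.

Section Action.
Variables (n : nat) (V : zmodType) (a : gaction n V).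

(** The coset [u * stab f] consists of the permutations with the same word [f \o u]. A translate of
    the symmetrizer thus depends only on this word, which plays the role of a tabloid. *)
Lemma symm_tabloid f u w :
  a u (symm a f w) = \sum_(v : {perm 'I_n} | [forall k, f (v k) == f (u k)]) a v w.
Proof.
rewrite /symm raddf_sum (reindex_inj (mulgI u^-1%g)) /=.
apply: eq_big => [v|v _]; last by rewrite -gaM mulKVg.
apply/stabP/forallP => H k.
  by have := H (u k); rewrite permM permK => ->.
by rewrite permM (eqP (H _)) permKV.
Qed.

Lemma symm_stabl f u w : u \in stab f -> a u (symm a f w) = symm a f w.
Proof.
move=> /stabP us; rewrite symm_tabloid; apply: eq_bigl => v; rewrite inE.
by apply: eq_forallb => k; rewrite us.
Qed.

Lemma symm_conj f u w : a u (symm a f w) = symm a (f \o u) (a u w).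
Proof.
rewrite symm_tabloid /symm [RHS](eq_bigr (fun g => a (g * u)%g w)) => [|g _]; last by rewrite gaM.
rewrite [RHS](reindex_inj (mulIg u^-1%g)) /=.
apply: eq_big => [v|v _]; last by rewrite mulgKV.
rewrite inE; apply: eq_forallb => k /=.
by rewrite permM permKV.
Qed.

Lemma symm_ker f f' w : (forall i j, (f i == f j) = (f' i == f' j)) ->
  symm a f w = symm a f' w.
Proof. by move=> H; apply: eq_bigl => g; rewrite !inE; apply: eq_forallb => k. Qed.

Variable N : V -> Prop.
Hypothesis sN : subgroup_pred N.

(** [P] is a union of cosets [stab f * u], and each of them sums to a symmetrizer applied to
    [a u w]. In [sub_sum_tabloid] the cosets are [u * stab f]. *)
Lemma sub_sum_left f (P : pred {perm 'I_n}) w :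
  (forall h u, h \in stab f -> P (h * u)%g = P u) ->
  (forall u, P u -> N (symm a f (a u w))) ->
  N (\sum_(u | P u) a u w).
Proof.
move=> PE H; apply: (@sub_sum_blocks _ _ sN _ _ (fun u => [set v | (v * u^-1)%g \in stab f])).
- by move=> u; rewrite inE mulgV stab1.
- move=> u v; rewrite !inE => vu; apply/setP => x; rewrite inE [RHS]inE.
  apply/idP/idP => xs.
    by rewrite -[x](mulgKV v) -mulgA stabM // inE.
  by rewrite -(mulgKV u x) -mulgA -[(u * _)%g]invgK invMg invgK stabM // stabV // inE.
- by move=> u v; rewrite inE => vs; rewrite -(PE _ u vs) mulgKV.
move=> u Pu; move: (H u Pu); congr N; rewrite /symm (reindex_inj (mulIg u^-1%g)) /=.
by apply: eq_big => [v|v _]; [rewrite [RHS]inE|rewrite -gaM mulgKV].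
Qed.

Lemma sub_sum_tabloid f (P : pred {perm 'I_n}) w :
  (forall u v : {perm 'I_n}, (forall k, f (u k) = f (v k)) -> P u = P v) ->
  (forall u, P u -> N (a u (symm a f w))) ->
  N (\sum_(u | P u) a u w).
Proof.
move=> PE H.
apply: (@sub_sum_blocks _ _ sN _ _ (fun u : {perm 'I_n} =>
          [set v : {perm 'I_n} | [forall k, f (v k) == f (u k)]])).
- by move=> u; rewrite inE; apply/forallP.
- move=> u v; rewrite inE => /forallP E; apply/setP => x; rewrite !inE.
  by apply: eq_forallb => k; rewrite (eqP (E k)).
- by move=> u v; rewrite inE => /forallP E; apply: PE => k; apply/eqP.
move=> u Pu; move: (H u Pu); congr N; rewrite symm_tabloid.
by apply: eq_bigl => v; rewrite inE.
Qed.

Variables (mu : seq nat) (w0 : V).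
Hypothesis Pmu : is_partition n mu.
Hypothesis HN : forall nu, is_partition n nu -> sdominates nu mu ->
  forall g h, N (a g (symm a (rowf n nu) (a h w0))).
Let row := rowf n mu.

(** The shape [nu] obtained by sorting [f] strictly dominates [mu], and conjugation by [h] turns the
    symmetrizer of [f] into that of [nu], where [HN] applies. *)
Lemma symm_higher f :
  (forall m, (sumn (take m mu) <= #|[set k | (f k < m)%N]|)%N) ->
  (exists m, (sumn (take m mu) < #|[set k | (f k < m)%N]|)%N) ->
  forall u, N (symm a f (a u w0)).
Proof.
move=> le [m lt] u; have [nu [h [Pnu ker cov]]] := shape_exists f.
rewrite (@symm_ker f (rowf n nu \o h)); last by move=> i j; rewrite ker.
rewrite -[a u w0](ga1 a) -(mulgV h) gaM -symm_conj -gaM; apply: HN => //.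
apply/(sdominates_sumnP Pnu Pmu); split => [k|].
  exact: leq_trans (le k) (cov k).
by exists m; apply: leq_trans lt (cov m).
Qed.

(** The letter [q] of [f] stands for either of the rows [q] and [r]. The set is stable under left
    multiplication by [stab f], so the sum over it splits into symmetrizers of [f]. *)
Definition row_compat q r (f : 'I_n -> nat) (u : {perm 'I_n}) :=
  [forall k, if f k == q then (row (u k) == q) || (row (u k) == r) else row (u k) == f k].

Lemma sum_compat q r f : (q < r)%N ->
  (forall m, (sumn (take m mu) + (q < m <= r) <= #|[set k | (f k < m)%N]|)%N) ->
  N (\sum_(u | row_compat q r f u) a u w0).
Proof.
move=> qr H; apply: (@sub_sum_left f) => [h u /stabP hs|u _].
  apply/forallP/forallP => E k.
    by have := E (h^-1 k)%g; rewrite permM permKV -(hs (h^-1 k)%g) permKV.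
  by have := E (h k); rewrite permM hs.
apply: symm_higher => [m|]; first by have := H m; lia.
by exists r; have := H r; rewrite leqnn qr; lia.
Qed.

Definition merge_rows q r (f : 'I_n -> nat) (D : {set 'I_n}) k :=
  if (f k == q) || (f k == r) then if k \in D then r else q else f k.

(** Of the points of rows [q] and [r], only [D] is left in row [r]. It is smaller than that row of
    [mu], so row [q] gains a point, which counts in the partial sums from [q.+1] to [r]. *)
Lemma card_merge q r (g : {perm 'I_n}) (D : {set 'I_n}) : (q < r)%N ->
  (forall k, k \in D -> row (g k) = q \/ row (g k) = r) ->
  (#|D| < nth 0 mu r)%N ->
  forall m, (sumn (take m mu) + (q < m <= r) <=
    #|[set k | (merge_rows q r (fun k => row (g k)) D k < m)%N]|)%N.
Proof.
move=> qr DE Dr m; rewrite -(card_row_ltn m Pmu) -(card_perm_set g (fun k => (rowf n mu k < m)%N)).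
case: (boolP (q < m <= r)%N) => [/andP[qm mr]|nqm]; last first.
  rewrite addn0 subset_leq_card //; apply/subsetP => k; rewrite !inE -/(row _) /merge_rows.
  by case: ifP => [/orP[/eqP ->|/eqP ->]|//]; case: ifP => _; lia.
set A := [set k | _]; set B := [set k | _].
have E : (#|A| + #|[set k | row (g k) == r]| <= #|B :|: D|)%N.
  rewrite -cardsUI [X in (_ + X)%N](_ : _ = 0%N) ?addn0.
    apply: subset_leq_card; apply/subsetP => k; rewrite !inE /merge_rows -/(row _).
    case: (k \in D); rewrite ?orbT ?orbF //.
    by case: ifP => [_ _|/negbT/norP[_ /negPf ->]]; rewrite ?orbF.
  apply/eqP; rewrite cards_eq0; apply/eqP/setP => k; rewrite !inE -/(row _).
  by apply/negP => /andP[lt /eqP E]; move: lt; rewrite -/(row _) E; lia.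
have := cardsUI B D; move: E; rewrite (card_perm_set g (fun k => row k == r)) card_row_eq //.
rewrite addn1 => E1 E2; rewrite -(leq_add2r #|D|) -E2.
by apply: leq_trans (leq_trans _ E1) (leq_addr _ _); rewrite addSn -addnS leq_add2l.
Qed.

Lemma sum_merge q r (g : {perm 'I_n}) (D : {set 'I_n}) : (q < r)%N ->
  (forall k, k \in D -> row (g k) = q \/ row (g k) = r) ->
  (#|D| < nth 0 mu r)%N ->
  N (\sum_(u | row_compat q r (merge_rows q r (fun k => row (g k)) D) u) a u w0).
Proof. by move=> qr DE Dr; apply: sum_compat => //; apply: card_merge. Qed.

(** Pulling [i] up to row [q] gives a word above [mu], so the permutations compatible with it sum
    into [N]. Grouped by the point [j] that goes to the old row of [i], they form the cosets of the
    row stabilizer represented by [tperm j i]. *)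
Lemma symm_row_swap q (i : 'I_n) : (q < row i)%N ->
  N (symm a row w0 + \sum_(j : 'I_n | row j == q) a (tperm j i) (symm a row w0)).
Proof.
move=> qi; pose r := row i.
pose D := [set k : 'I_n | (row k == r) && (k != i)].
have cD : #|D|.+1 = nth 0%N mu r.
  rewrite -(card_row_eq r Pmu) [RHS](cardsD1 i) inE eqxx add1n; congr _.+1.
  by congr #|pred_of_set _|; apply/setP => k; rewrite !inE andbC.
have : N (\sum_(u | row_compat q r (merge_rows q r (fun k => row ((1%g : {perm 'I_n}) k)) D) u) a u w0).
  apply: sum_merge => // [k|]; last by rewrite -cD.
  by rewrite inE perm1 => /andP[/eqP ->]; right.
set C := row_compat _ _ _.
(* each compatible u has exactly one j in row q or equal to i sent to row r *)
pose Q (j : 'I_n) := (row j == q) || (j == i).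
have CE u : C u = [forall k, if Q k then (row (u k) == q) || (row (u k) == r) else row (u k) == row k].
  apply: eq_forallb => k; rewrite /merge_rows perm1 /Q inE.
  case: (eqVneq (row k) q) => [E|kq] /=.
    by rewrite E (ltn_eqF qi) /= eqxx.
  case: (eqVneq k i) => [->|ki] /=; first by rewrite /r eqxx andbF eqxx.
  rewrite andbT; case: (eqVneq (row k) r) => [->|_]; last by rewrite (negPf kq).
  by rewrite (gtn_eqF qi).
have uniqj u : C u -> exists2 j, Q j & forall k, (Q k && (row (u k) == r)) = (k == j).
  rewrite CE => /forallP Cu.
  have : #|[set k | Q k && (row (u k) == r)]| == 1%N.
    have E1 : #|[set k | row (u k) == r]| = #|D|.+1.
      by rewrite (card_perm_set u (fun k => row k == r)) card_row_eq // cD.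
    have E2 := cardsID D [set k | row (u k) == r].
    have E3 : [set k | row (u k) == r] :&: D = D.
      apply/setP => k; rewrite !inE; have := Cu k; rewrite /Q.
      case: (eqVneq (row k) r) => [E|]; rewrite ?andbF //=.
      case: (eqVneq k i) => [->|ki]; rewrite ?andbF //= orbF E (gtn_eqF qi) => ->.
      by [].
    have E4 : [set k | row (u k) == r] :\: D = [set k | Q k && (row (u k) == r)].
      apply/setP => k; rewrite !inE; have := Cu k; rewrite /Q.
      case: (eqVneq k i) => [->|ki]; rewrite ?andbF ?orbT ?andbT ?orbF //.
      by case: (eqVneq (row k) q) => [->|kq]; [rewrite (ltn_eqF qi)|move/eqP ->; rewrite andNb].
    by move: E2; rewrite E3 E1 E4 -addn1 => /addnI ->.
  case/cards1P => j E; exists j => [|k].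
    by have := set11 j; rewrite -E inE => /andP[].
  by have := in_set1 k j; rewrite -E inE.
have -> : symm a row w0 + \sum_(j | row j == q) a (tperm j i) (symm a row w0) =
    \sum_(j | Q j) a (tperm j i) (symm a row w0).
  rewrite [RHS](bigD1 i) /=; last by rewrite /Q eqxx orbT.
  rewrite tperm1 ga1; congr (_ + _); apply: eq_bigl => j.
  rewrite /Q; case: (eqVneq j i) => [->|_]; rewrite ?andbF ?orbF ?andbT //.
  by rewrite (gtn_eqF qi).
congr N.
pose jj (u : {perm 'I_n}) := odflt i [pick j | Q j && (row (u j) == r)].
have jjE u : C u -> Q (jj u) /\ forall k, (Q k && (row (u k) == r)) = (k == jj u).
  move=> /uniqj[j Qj H]; rewrite /jj; case: pickP => [k /= Qk|]; last by move/(_ j); rewrite H eqxx.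
  have := Qk; rewrite H => /eqP ->; split => //.
rewrite (partition_big jj Q) => [|u /jjE[]//].
apply: eq_bigr => j Qj; rewrite symm_tabloid; apply: eq_bigl => u.
apply/andP/forallP => [[Cu /eqP jE]|H].
  have [_ H] := jjE _ Cu; rewrite jE in H.
  move: Cu; rewrite CE => /forallP Cu k; have := H k; have := Cu k.
  case: tpermP => [->|->|kj ki].
  - by rewrite eqxx Qj /= => _ ->.
  - rewrite {1 2}/Q eqxx orbT /= => /orP[] /eqP -> ; rewrite ?eqxx ?(ltn_eqF qi) => E.
      move: Qj; rewrite /Q => /orP[/eqP ->//|/eqP E'].
      by rewrite E' eqxx in E.
    by rewrite -(eqP (esym E)) /=.
  rewrite /Q (negPf (introN eqP ki)) (negPf (introN eqP kj)) orbF.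
  case: (eqVneq (row k) q) => [->|_] //=.
  by case/orP => // ->.
have Cu : C u.
  rewrite CE; apply/forallP => k; rewrite (eqP (H k)).
  case: tpermP => [->|->|kj ki]; first by rewrite Qj eqxx orbT.
    by rewrite /Q eqxx orbT; move: Qj => /orP[/eqP ->|/eqP ->]; rewrite eqxx ?orbT.
  by rewrite /Q (negPf (introN eqP ki)) orbF; case: ifP => // ->.
split => //; rewrite eq_sym; have [_ <-] := jjE _ Cu.
by rewrite Qj (eqP (H j)) tpermL /=.
Qed.

End Action.

(** * Jucys-Murphy triangularity and straightening *)

Lemma rowf_le n l (j i : 'I_n) : is_partition n l -> (j <= i)%N ->
  (rowf n l j <= rowf n l i)%N.
Proof.
move=> /partition_sumn El ji; rewrite -ltnS /rowf rowcol_row_ltn ?El //.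
by apply: leq_ltn_trans ji _; rewrite -rowcol_row_ltn ?El.
Qed.

Definition cnt n (f : 'I_n -> nat) m r := #|[set k : 'I_n | (k < m)%N && (f k == r)]|.

Lemma cnt_rowf n l (i : 'I_n) : is_partition n l ->
  cnt (rowf n l) i (rowf n l i) = colf n l i.
Proof.
move=> Pl; have El := partition_sumn Pl.
have := cardsID [set k : 'I_n | (rowf n l k < rowf n l i)%N] [set k : 'I_n | (k < i)%N].
rewrite card_ltn ?(ltnW (ltn_ord i)) //.
rewrite (_ : _ :&: _ = [set k : 'I_n | (rowf n l k < rowf n l i)%N]).
  rewrite card_row_ltn // => E; rewrite /colf; have /addnI <- := etrans E (rowcol_pos l i); rewrite /cnt.
  congr #|pred_of_set _|; apply/setP => k; rewrite !inE -leqNgt eqn_leq.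
  by case: ltnP => [/ltnW/(rowf_le Pl) ->|]; rewrite ?andbT ?andbF.
apply/setP => k; rewrite !inE andbC andb_idr // => lt.
by rewrite ltnNge; apply: contraL lt => /(rowf_le Pl); rewrite -leqNgt.
Qed.

Lemma cnt_lt n (f : 'I_n -> nat) (x y : 'I_n) m r : f x = r -> (x < m)%N -> (y <= x)%N ->
  (cnt f y r < cnt f m r)%N.
Proof.
move=> fx xm yx; apply: proper_card; apply/properP; split; last first.
  by exists x; rewrite !inE ?fx ?eqxx ?xm // ltnNge yx.
by apply/subsetP => k; rewrite !inE => /andP[ky ->]; rewrite andbT; lia.
Qed.

Lemma cnt_le n (f : 'I_n -> nat) m m' r : (m <= m')%N -> (cnt f m r <= cnt f m' r)%N.
Proof.
move=> mm; apply: subset_leq_card; apply/subsetP => k; rewrite !inE => /andP[km ->].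
by rewrite andbT; lia.
Qed.

Lemma cnt_max n (f : 'I_n -> nat) m r : (cnt f m r <= cnt f n r)%N.
Proof. by apply: subset_leq_card; apply/subsetP => k; rewrite !inE ltn_ord => /andP[]. Qed.

Lemma cnt_total n l (g : {perm 'I_n}) r : is_partition n l ->
  cnt (fun k => rowf n l (g k)) n r = nth 0%N l r.
Proof.
move=> Pl; rewrite -(card_row_eq r Pl) -(card_perm_set g).
by congr #|pred_of_set _|; apply/setP => k; rewrite !inE ltn_ord.
Qed.

(** The hypothesis says that the row word is a lattice word. Put [x] in row [f x], in the column
    numbered by the earlier occurrences of the same letter: rows then increase by construction, and
    columns by the lattice condition. *)
Lemma standard_of_dominant_word n mu (g : {perm 'I_n}) : is_partition n mu ->
  (forall m r, (cnt (fun k => rowf n mu (g k)) m r.+1 <=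
                cnt (fun k => rowf n mu (g k)) m r)%N) ->
  exists2 d : {perm 'I_n}, is_standard mu n d &
    forall k, rowf n mu (d^-1 k)%g = rowf n mu (g k).
Proof.
move=> Pmu; set f := fun k => _ => Y.
pose c (x : 'I_n) := cnt f x (f x).
have cx x : (c x < nth 0 mu (f x))%N.
  by rewrite -(cnt_total g (f x) Pmu); apply: (@cnt_lt _ _ x).
have elt x : (sumn (take (f x) mu) + c x < n)%N.
  by rewrite -[ltnRHS](partition_sumn Pmu) node_ltn.
have ec x y : f x = f y -> (x < y)%N -> (c x < c y)%N.
  by move=> E xy; rewrite /c -E; apply: (@cnt_lt _ _ x).
have einj : injective (fun x => Ordinal (elt x)).
  move=> x y /(congr1 (fun k : 'I_n => rowcol mu k)) /=.
  rewrite !rowcol_node // => -[E1 E2]; apply/val_inj.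
  by case: (ltngtP x y) => // /ec; rewrite E1 ?E2 ltnn => /(_ erefl).
pose e := perm einj.
have rce x : rowcol mu (e x) = (f x, c x) by rewrite permE /= rowcol_node.
exists (e^-1)%g; last by move=> k; rewrite invgK {1}/rowf rce.
apply/forallP => k; apply/forallP => k'; apply/implyP.
rewrite -{1 2 3 4}(permKV e k) -{1 2 3 4}(permKV e k').
set x := (e^-1)%g k; set y := (e^-1)%g k'; rewrite !rce /=.
rewrite ltnNge => H; apply/negP => yx; move: H.
case/orP => /andP[/eqP E1 /eqP E2].
  have : (c y <= c x)%N by rewrite /c E1; apply: cnt_le.
  by rewrite E2 ltnn.
have yx' : (y < x)%N.
  rewrite ltn_neqAle yx andbT; apply: contra_eqN E1 => /eqP/val_inj ->.
  by rewrite neq_ltn ltnSn.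
(* With [y] before [x], the prefix ending at [y] would contain more letters [(f x).+1] than letters
   [f x]. *)
have := Y y.+1 (f x); apply/negP; rewrite -ltnNge.
apply: (@leq_ltn_trans (c x)); first exact: cnt_le.
by rewrite -E2 /c E1; apply: (@cnt_lt _ _ y).
Qed.

Section Action.
Variables (n : nat) (V : zmodType) (a : gaction n V) (N : V -> Prop).
Hypothesis sN : subgroup_pred N.
Variables (mu : seq nat) (w0 : V).
Hypothesis Pmu : is_partition n mu.
Hypothesis HN : forall nu, is_partition n nu -> sdominates nu mu ->
  forall g h, N (a g (symm a (rowf n nu) (a h w0))).
Let row := rowf n mu.

(** Transpositions of [i] with earlier points of its own row fix the symmetrizer, one for each
    column to the left. By [symm_row_swap] each full row above contributes [-1]. The total is column
    minus row. *)
Lemma jm_symm (i : 'I_n) :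
  N (jm a i (symm a row w0) - symm a row w0 *~ content mu i).
Proof.
set S := symm a row w0.
have H m : (m <= row i)%N ->
    N (S *+ m + \sum_(j : 'I_n | (row j < m)%N) a (tperm j i) S).
  elim: m => [|m IH] mi; first by rewrite mulr0n big_pred0 ?addr0 //; apply: sub0 sN.
  rewrite (bigID (fun j => row j == m)) /= mulrS addrACA.
  rewrite (eq_bigl (fun j => row j == m)); last first.
    by move=> j; rewrite ltnS andbC; case: eqP => // ->; rewrite leqnn.
  rewrite [X in _ + (_ + X)](eq_bigl (fun j => (row j < m)%N)); last first.
    by move=> j; rewrite ltnS ltn_neqAle andbC.
  apply: (subD sN); last by apply: IH; apply: ltnW.
  exact: (symm_row_swap sN Pmu HN).
have -> : jm a i S = S *+ colf n mu i + \sum_(j : 'I_n | (row j < row i)%N) a (tperm j i) S.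
  rewrite /jm (bigID (fun j => row j == row i)) /=; congr (_ + _).
    rewrite (eq_bigr (fun=> S)) => [|j /andP[_ /eqP E]]; last first.
      by apply: symm_stabl; apply/stabP => k; case: tpermP => // ->.
    rewrite sumr_const -(cnt_rowf i Pmu); congr (_ *+ _).
    by rewrite /cnt cardsE; apply: eq_card.
  apply: eq_bigl => j; rewrite (ltn_neqAle (row j)) andbC; case: eqVneq => //= ne.
  apply/idP/idP => [/ltnW/(rowf_le Pmu)//|le].
  by rewrite ltnNge; apply: contra ne => /(rowf_le Pmu) ge; rewrite eqn_leq le.
rewrite /content -/(rowf n mu i) -/(colf n mu i) mulrzBr -!pmulrn opprB.
by rewrite addrC addrA subrK; apply: H.
Qed.

(** A Garnir relation: [X'] must keep the letter [r] and [Y'] the letter [r.+1]. By hypothesis [X']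
    and [Y'] together are smaller than row [r.+1], so the sums with [Y'] and any part [E] of [X']
    forced into that row are in [N] by [sum_merge]. Inclusion-exclusion over [E] then forces all of
    [X'] into row [r]. *)
Lemma sum_garnir m r (g : {perm 'I_n}) (f := fun k => row (g k)) :
  (cnt f m r < cnt f m r.+1)%N ->
  N (\sum_(u : {perm 'I_n} | [forall k : 'I_n,
      if ((m <= k)%N && (f k == r)) || ((k < m)%N && (f k == r.+1))
      then (row (u k) == r) || (row (u k) == r.+1) else row (u k) == f k]) a u w0).
Proof.
move=> lt.
have r1r : (r.+1 == r) = false by rewrite gtn_eqF.
have rr1 : (r == r.+1) = false by rewrite ltn_eqF.
have rw := (r1r, rr1, eqxx, andbT, andbF, orbT, orbF, andTb, orTb, orFb).
pose X' := [set k : 'I_n | (k < m)%N && (f k == r)].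
pose Y' := [set k : 'I_n | (m <= k)%N && (f k == r.+1)].
pose C (E : {set 'I_n}) (u : {perm 'I_n}) := row_compat mu r r.+1 (merge_rows r r.+1 f (Y' :|: E)) u.
have DE (E : {set 'I_n}) : E \subset X' ->
    (forall k, k \in Y' :|: E -> f k = r \/ f k = r.+1) /\
    (#|Y' :|: E| < nth 0 mu r.+1)%N.
  move=> EX; split=> [k|].
    rewrite !inE => /orP[/andP[_ /eqP]|]; first by right.
    by move/(subsetP EX); rewrite inE => /andP[_ /eqP]; left.
  rewrite -(cnt_total g r.+1 Pmu).
  have -> : cnt f n r.+1 = (#|Y'| + cnt f m r.+1)%N.
    rewrite /cnt -cardsUI [X in (_ + X)%N](_ : _ = 0%N) ?addn0.
      congr #|pred_of_set _|; apply/setP => k; rewrite !inE ltn_ord.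
      by case: (f k == _); rewrite ?andbF // !andbT; case: leqP.
    by apply/eqP; rewrite cards_eq0; apply/eqP/setP => k; rewrite !inE; lia.
  apply: leq_ltn_trans (_ : #|Y'| + #|X'| < _)%N; last by rewrite ltn_add2l.
  by apply: leq_trans (leq_card_setU _ _) _; rewrite leq_add2l subset_leq_card.
(* inclusion-exclusion, one element of X' at a time *)
have IE (s : seq 'I_n) : {subset s <= X'} -> forall E : {set 'I_n}, E \subset X' ->
    N (\sum_(u | C E u && all (fun k => row (u k) == r) s) a u w0).
  elim: s => [|k s IH] sX E EX.
    rewrite (eq_bigl (C E)) => [|u]; last by rewrite andbT.
    have [D1 D2] := DE E EX; exact: (sum_merge sN Pmu HN).
  have kX : k \in X' by apply: sX; rewrite mem_head.
  have sX' : {subset s <= X'} by move=> x xs; apply: sX; rewrite inE xs orbT.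
  have EkX : k |: E \subset X' by rewrite subUset sub1set kX.
  apply: (subDr sN (IH sX' _ EkX)).
  have := IH sX' E EX; congr N.
  rewrite (bigID (fun u : {perm 'I_n} => row (u k) == r)) /=; congr (_ + _); apply: eq_bigl => u.
    by rewrite -andbA; congr andb; rewrite andbC.
  rewrite andbAC; congr andb.
  have fk : f k = r by move: kX; rewrite inE => /andP[_ /eqP].
  apply/andP/forallP => [[/forallP Cu ur] x|Cu].
    have := Cu x; rewrite /merge_rows !inE.
    case: (eqVneq x k) => [->|//]; rewrite fk eqxx /= orbT.
    rewrite (_ : r.+1 == r = false); last by rewrite gtn_eqF.
    by case: (_ || (k \in E)); rewrite ?(gtn_eqF (ltnSn r)) // eqxx /= => /orP[/idPn|].
  have ur : row (u k) = r.+1.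
    apply/eqP; have := Cu k; rewrite /merge_rows !inE fk !eqxx /= orbT.
    by rewrite (gtn_eqF (ltnSn r)).
  split; last by rewrite ur gtn_eqF.
  apply/forallP => x; have := Cu x; rewrite /merge_rows !inE.
  case: (eqVneq x k) => [->|//] _; rewrite -/(row (u k)) fk eqxx ur /= (eqxx r.+1) orbT.
  by case: (_ || (k \in E)); rewrite !rw.
have : N (\sum_(u | C set0 u && all (fun k => row (u k) == r) (enum X')) a u w0).
  by apply: IE (sub0set _) => x; rewrite mem_enum.
congr N; apply: eq_bigl => u.
apply/andP/forallP => [[/forallP Cu /allP Au] k|H].
  have := Cu k; have := Au k; rewrite mem_enum /merge_rows !inE.
  case: (eqVneq (f k) r) => [->|kr]; rewrite !rw.
    by case: leqP => // km /(_ isT).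
  case: (eqVneq (f k) r.+1) => [->|kr1]; rewrite ?rw; last by rewrite (negPf kr).
  by case: leqP; rewrite ?rw.
split; last first.
  apply/allP => k; rewrite mem_enum inE => /andP[km /eqP fk]; have := H k.
  by rewrite fk leqNgt km !rw.
apply/forallP => k; have := H k; rewrite /merge_rows !inE.
case: (eqVneq (f k) r) => [->|kr]; rewrite ?rw.
  by case: leqP => // km ->.
case: (eqVneq (f k) r.+1) => [->|kr1]; rewrite ?rw; last by rewrite (negPf kr).
by case: leqP; rewrite ?rw.
Qed.

(** Induction on a weight [W] of the row word, bounded by [B]. A lattice word comes from a standard
    tableau. Where the lattice condition fails, the Garnir relation rewrites the translate by words
    in which letters [r.+1] have moved to later positions in exchange for letters [r], and these
    weigh more. *)
Lemma straighten :
  (forall d : {perm 'I_n}, is_standard mu n d -> N (a d^-1%g (symm a row w0))) ->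
  forall g, N (a g (symm a row w0)).
Proof.
move=> HS.
pose W (g : {perm 'I_n}) := (\sum_(k < n) (k.*2 + 1) * row (g k))%N.
pose B := (\max_(g : {perm 'I_n}) W g)%N.
move=> g; have [k le] := ubnP (B - W g); elim: k g le => // k IH g le.
pose f := fun k => row (g k).
have [/forallP Y|/forallPn[m /forallPn[r]]] :=
  boolP [forall m : 'I_n.+1, [forall r : 'I_(size mu), (cnt f m r.+1 <= cnt f m r)%N]].
  have cnt_big r m : (size mu <= r)%N -> cnt f m r.+1 = 0%N.
    move=> nr; apply/eqP; rewrite -leqn0.
    rewrite -(nth_default 0%N (leqW nr)) -(cnt_total g r.+1 Pmu).
    exact: cnt_max.
  have [d sd E] : exists2 d : {perm 'I_n}, is_standard mu n d &
      forall k, rowf n mu (d^-1 k)%g = rowf n mu (g k).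
    apply: standard_of_dominant_word => // m r.
    case: (ltnP r (size mu)) => rn; last by rewrite cnt_big.
    case: (ltnP m n.+1) => mn; first by have /forallP := Y (Ordinal mn) => /(_ (Ordinal rn)).
    have /forallP/(_ (Ordinal rn)) /= := Y ord_max.
    by move=> H; apply: leq_trans (leq_trans (cnt_max _ _ _) H) _; apply: cnt_le; lia.
  have := HS d sd; congr N; rewrite !symm_tabloid; apply: eq_bigl => u.
  by apply: eq_forallb => x; rewrite /row E.
rewrite -ltnNge => lt.
have := sum_garnir lt; rewrite (bigID (fun u : {perm 'I_n} => [forall k, row (u k) == row (g k)])) /=.
set S1 := \sum_(_ | _) _; set S2 := \sum_(_ | _) _.
have -> : S1 = a g (symm a row w0).
  rewrite symm_tabloid; apply: eq_bigl => u; rewrite andb_idl //.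
  move=> /forallP E; apply/forallP => x; rewrite (eqP (E x)) -/(f x).
  by case: ifP => //; case/orP => /andP[_ ->]; rewrite ?orbT.
move=> H; apply: (subDr sN _ H).
apply: (@sub_sum_tabloid _ _ a N sN row) => [u v E|u /andP[/forallP H1 /forallPn[y ny]]].
  by congr (_ && ~~ _); apply: eq_forallb => x; rewrite E.
apply: IH; suff WW : (W g < W u)%N.
  have WB : (W u <= B)%N by apply: leq_bigmax.
  by move: (W g) (W u) B WW WB le => wg wu b; lia.
have sumE (v : {perm 'I_n}) : (\sum_(k < n) row (v k) = \sum_(k < n) row k)%N.
  by rewrite [RHS](reindex_inj (@perm_inj _ v)).
(* The number [2x + 1 - 2m] is odd, positive from [m] on, where letters can only grow, and negative
   before [m], where they can only drop. So the inequality is strict wherever the letter changes.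
   After summation the terms in [m] cancel, as both words have the same letter sum. *)
have T (x : 'I_n) : ((x.*2 + 1) * row (g x) + m.*2 * row (u x) <= (x.*2 + 1) * row (u x) + m.*2 * row (g x)
           ?= iff (row (u x) == row (g x)))%N.
  have := H1 x; rewrite /f; move: (row (u x)) (row (g x)) => h c.
  case: (leqP m x) => /= mx; rewrite ?orbF.
    case: (eqVneq c r) => [->|_ /eqP ->]; last by split; rewrite ?eqxx.
    case/orP => /eqP ->; first by split; rewrite ?eqxx.
    by split; [nia|rewrite (gtn_eqF (ltnSn r)); nia].
  case: (eqVneq c r.+1) => [->|_ /eqP ->]; last by split; rewrite ?eqxx.
  case/orP => /eqP ->; last by split; rewrite ?eqxx.
  by split; [nia|rewrite (ltn_eqF (ltnSn r)); nia].
have := leqif_sum (fun x (_ : xpredT x) => T x).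
case; rewrite !big_split /= -!big_distrr /= !sumE -/(W g) -/(W u) => H2 H3.
have : ~~ [forall (x | true), row (u x) == row (g x)] by apply/forallPn; exists y.
rewrite -H3; lia.
Qed.

End Action.

(** * Weights and the content sum *)

Definition content_sum n l : int := \sum_(i < n) content l i.

(** A row of length [b] and index [r] has content sum [b (b - 1 - 2r) / 2]; doubling avoids the
    division. The free bound [M] lets two shapes be summed over the same range. *)
Lemma double_content_sum l M : (size l <= M)%N ->
  2 * content_sum (sumn l) l =
    \sum_(r < M) ((nth 0%N l r)%:Z * ((nth 0%N l r)%:Z - 1 - 2 * r%:Z)).
Proof.
rewrite /content_sum; elim: l M => [|b l IH] [|M] //=.
- by move=> _; rewrite big_ord0 !big_ord0 mulr0.
- by move=> _; rewrite big_ord0 mulr0 big1 // => i _; rewrite nth_nil mul0r.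
rewrite ltnS => lM.
rewrite big_ord_recl /= big_split_ord /= mulrDr; congr (_ + _).
  rewrite mulr0 subr0 (eq_bigr (fun i : 'I_b => (i : nat)%:Z)) => [|i _]; last first.
    by rewrite /content /= ltn_ord subr0.
  elim: b => [|b IHb]; first by rewrite big_ord0 mul0r mulr0.
  by rewrite big_ord_recr /= mulrDr IHb; lia.
rewrite (eq_bigr (fun i : 'I_(sumn l) => content l i - 1)) => [|i _]; last first.
  rewrite /content /= ltnNge leq_addr /= addKn; lia.
rewrite sumrB sumr_const card_ord mulrBr (IH M) //.
have -> : sumn l = (\sum_(r < M) nth 0 l r)%N.
  elim: l M lM {IH} => [|c l IHl] [|M] //=; rewrite ?big_ord0 //.
    by rewrite big1 // => i _; rewrite nth_nil.
  by rewrite ltnS => lM; rewrite big_ord_recl /= (IHl M).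
rewrite natr_sum mulr_sumr.
by rewrite -sumrB; apply: eq_bigr => i _ /=; rewrite /bump /= add0n (natz (nth _ _ _)) PoszD; ring.
Qed.

(** Twice the difference of the content sums is [sum d^2 + 2 sum d h - sum d], and [sum d] is zero.
    As [h] drops by at least 1 at each step, Abel summation bounds [sum d h] below by the sum of the
    differences [Dl] of partial sums, which is positive. *)
Lemma content_sum_sdominates n nu l : is_partition n nu -> is_partition n l ->
  sdominates nu l -> content_sum n l < content_sum n nu.
Proof.
move=> Pn Pl /(sdominates_sumnP Pn Pl)[D [k0 lt0]].
pose M := (size nu + size l + k0)%N.
have En := partition_sumn Pn; have El := partition_sumn Pl.
have := @double_content_sum nu M; have := @double_content_sum l M.
rewrite En El => /(_ _) Hl /(_ _) Hn.
have {}Hl := Hl ltac:(rewrite /M; lia); have {}Hn := Hn ltac:(rewrite /M; lia).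
pose d r := (nth 0%N nu r)%:Z - (nth 0%N l r)%:Z.
pose Dl m := (sumn (take m nu))%:Z - (sumn (take m l))%:Z.
pose h r := (nth 0%N l r)%:Z - r%:Z.
have DlS m : Dl m.+1 = Dl m + d m by rewrite /Dl !sumn_takeS /d; lia.
have D0 m : 0 <= Dl m by rewrite /Dl subr_ge0 lez_nat.
have hS r : 1 <= h r - h r.+1.
  by have := partition_nth Pl (leqnSn r); rewrite /h; lia.
have Dl0 : Dl 0%N = 0 by rewrite /Dl !take0 subrr.
have abel m : \sum_(i < m.+1) Dl i <= \sum_(r < m) d r * h r - Dl m * h m.
  elim: m => [|m IH]; first by rewrite big_ord1 big_ord0 /= Dl0 mul0r subrr.
  rewrite big_ord_recr [in leRHS]big_ord_recr /=.
  have : Dl m.+1 <= Dl m.+1 * (h m - h m.+1) by rewrite ler_peMr.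
  move: IH; rewrite DlS; set S1 := \sum_(_ < _) _; set S2 := \sum_(_ < _) _.
  by move=> IH; rewrite mulrBr; lra.
have DM : Dl M = 0.
  by rewrite /Dl !take_oversize ?En ?El ?subrr // /M; lia.
have := abel M; rewrite DM mul0r subr0 => A.
have pos : 0 < \sum_(i < M.+1) Dl i.
  have k0M : (k0 < M.+1)%N by rewrite /M; lia.
  rewrite (bigD1 (Ordinal k0M)) //= ltr_wpDr ?sumr_ge0 //.
  by rewrite /Dl subr_gt0 ltz_nat.
have sd m : \sum_(r < m) d r = Dl m.
  elim: m => [|m IH]; first by rewrite big_ord0 Dl0.
  by rewrite big_ord_recr /= IH DlS.
have : 2 * content_sum n nu - 2 * content_sum n l =
    \sum_(r < M) d r ^+ 2 + 2 * \sum_(r < M) d r * h r - \sum_(r < M) d r.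
  rewrite Hl Hn -sumrB mulr_sumr -big_split -sumrB /=; apply: eq_bigr => r _.
  by rewrite /d /h; ring.
have : 0 <= \sum_(r < M) d r ^+ 2 by apply: sumr_ge0 => r _; rewrite sqr_ge0.
rewrite sd DM; lra.
Qed.

Section Weight.
Variables (n : nat) (V : zmodType) (a : gaction n V) (N : V -> Prop).
Hypothesis sN : subgroup_pred N.
Hypothesis stableN : forall g x, N x -> N (a g x).
Hypothesis satN : forall x k, N (x *+ k.+1) -> N x.

Lemma satz x (z : int) : z != 0 -> N (x *~ z) -> N x.
Proof.
case: z => [[|k]|k] //= _; first exact: satN.
by rewrite NegzE mulrNz => /(subN sN); rewrite opprK; apply: satN.
Qed.

Lemma symm_stable f x : N x -> N (symm a f x).
Proof. by move=> Nx; apply: (sub_sum sN) => g _; apply: stableN. Qed.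

Lemma symmB f : {morph symm a f : x y / x - y}.
Proof. by move=> x y; rewrite /symm -sumrB; apply: eq_bigr => g _; rewrite raddfB. Qed.

Lemma symmMz f z : {morph symm a f : x / x *~ z}.
Proof. by move=> x; rewrite /symm mulrz_suml; apply: eq_bigr => g _; rewrite raddfMz. Qed.

(** Each transposition occurs twice, once per ordered pair, which makes centrality a plain
    reindexing. *)
Definition tsum w := \sum_i \sum_(j | j != i) a (tperm j i) w.

Lemma tsumD : {morph tsum : x y / x + y}.
Proof.
move=> x y; rewrite /tsum -big_split; apply: eq_bigr => i _ /=.
by rewrite -big_split; apply: eq_bigr => j _; rewrite raddfD.
Qed.

Lemma tsum0 : tsum 0 = 0.
Proof. by have := tsumD 0 0; rewrite addr0 => /(congr1 (fun x => x - tsum 0)); rewrite subrr addrK. Qed.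

Lemma sum_jm_double w :
  (\sum_i jm a i w) *+ 2 = tsum w.
Proof.
rewrite /tsum mulr2n [X in X + _ = _](_ : _ = \sum_(i < n) \sum_(j < n | (i < j)%N) a (tperm j i) w).
  rewrite -big_split; apply: eq_bigr => i _ /=.
  rewrite [RHS](bigID (fun j : 'I_n => (i < j)%N)) /jm /=; congr (_ + _); apply: eq_bigl => j.
    by rewrite andb_idl // => lt; rewrite neq_ltn lt orbT.
  by rewrite -leqNgt ltn_neqAle.
rewrite (exchange_big_dep xpredT) //=; apply: eq_bigr => i _; apply: eq_bigr => j _.
by rewrite tpermC.
Qed.

Lemma sum_jm_central h w :
  a h (tsum w) = tsum (a h w).
Proof.
rewrite /tsum [RHS](reindex_inj (@perm_inj _ h^-1%g)) raddf_sum; apply: eq_bigr => i _ /=.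
rewrite [RHS](reindex_inj (@perm_inj _ h^-1%g)) raddf_sum /=.
apply: eq_big => [j|j _]; first by rewrite (inj_eq (@perm_inj _ _)).
by rewrite -!gaM -tpermJ conjgE invgK mulgA mulgKV.
Qed.

Variables (l : seq nat) (v : V).
Hypothesis Pl : is_partition n l.
Hypothesis weight : forall i, N (jm a i v - v *~ content l i).

Lemma sum_jm_weight x (c : 'I_n -> int) :
  (forall i, N (jm a i x - x *~ c i)) ->
  N (tsum x - x *~ (2 * \sum_i c i)).
Proof.
move=> H; rewrite -sum_jm_double mulrC mulrzA -pmulrn -mulrnBl; apply: (subMn sN).
by rewrite mulrz_sumr -sumrB; apply: (sub_sum sN).
Qed.

(* The sum of all transpositions is central, so it separates the weights of
   two comparable shapes; a vector of weight l is killed by larger shapes. *)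
Lemma symm_sdominates_weight nu : is_partition n nu -> sdominates nu l ->
  forall g h, N (a g (symm a (rowf n nu) (a h v))).
Proof.
move=> Pnu; elim/(@sdominates_ind n): Pnu => {}nu Pnu IH D g h.
apply: stableN; set x := symm _ _ _.
(* By induction the shapes above [nu] kill [v], so [jm_symm] gives [x] the weight of [nu]. *)
have Wnu : N (tsum x - x *~ (2 * content_sum n nu)).
  apply: sum_jm_weight => i; apply: (jm_symm sN Pnu) => nu' Pnu' D' g' h'.
  by rewrite -gaM; apply: IH => //; exact: (sdominates_trans Pnu' Pnu Pl D' D).
have Wl : N (tsum x - x *~ (2 * content_sum n l)).
  have := symm_stable (rowf n nu) (stableN h (sum_jm_weight weight)).
  congr N; rewrite raddfB /= sum_jm_central raddfMz symmB symmMz /symm; congr (_ - _).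
  rewrite /x /symm (big_morph _ tsumD tsum0); apply: eq_bigr => k _.
  exact: sum_jm_central.
have := subB sN Wnu Wl; rewrite opprB addrC subrKA -mulrzBr => H.
apply: satz H; rewrite -mulrBr mulf_eq0 /= subr_eq0.
by rewrite lt_eqF // content_sum_sdominates.
Qed.
End Weight.

(** * Restriction to a smaller symmetric group *)

Definition lift_last n (g : {perm 'I_n}) : {perm 'I_n.+1} := lift_perm ord_max ord_max g.

Lemma lift_last_inj n : injective (@lift_last n).
Proof.
move=> g h E; apply/permP => k; apply: (@lift_inj _ ord_max).
by rewrite -!(lift_perm_lift ord_max ord_max) -/(lift_last _) E.
Qed.

Lemma fix_last_lift n (h : {perm 'I_n.+1}) : h ord_max = ord_max ->
  exists g : {perm 'I_n}, h = lift_last g.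
Proof.
move=> hm; pose e k := odflt k (unlift ord_max (h (lift ord_max k))).
have eE k : lift ord_max (e k) = h (lift ord_max k).
  rewrite /e; case: unliftP => [j ->//|E].
  by have := neq_lift ord_max k; rewrite -(inj_eq (@perm_inj _ h)) E hm eqxx.
have einj : injective e.
  move=> j k /(congr1 (lift ord_max)); rewrite !eE => /perm_inj; exact: lift_inj.
exists (perm einj); apply/permP => k; case: (unliftP ord_max k) => [j ->|->].
  by rewrite lift_perm_lift permE eE.
by rewrite lift_perm_id.
Qed.

Lemma lift_last_tperm n (j i : 'I_n) :
  lift_last (tperm j i) = tperm (lift ord_max j) (lift ord_max i).
Proof.
apply/permP => k; case: (unliftP ord_max k) => [m ->|->].
  rewrite lift_perm_lift; case: tpermP => [->|->|mj mi]; rewrite ?tpermL ?tpermR //.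
  by rewrite tpermD // (inj_eq (@lift_inj _ _)) eq_sym; apply/eqP.
by rewrite lift_perm_id tpermD // eq_sym neq_lift.
Qed.

Section Restrict.
Variables (n : nat) (V : zmodType) (a : gaction n.+1 V).

Fact res_ga1 x : a (lift_last 1%g) x = x.
Proof. by rewrite /lift_last lift_perm1 ga1. Qed.
Fact res_gaM g h x : a (lift_last (g * h)) x = a (lift_last g) (a (lift_last h) x).
Proof. by rewrite -gaM /lift_last lift_permM. Qed.
Definition restrict : gaction n V :=
  GAction (fun g => gaD a (lift_last g)) res_ga1 res_gaM.

Lemma jm_restrict (i : 'I_n) w : jm restrict i w = jm a (lift ord_max i) w.
Proof.
rewrite /jm [RHS]big_mkcond big_ord_recr /= /bump (leqNgt n i) ltn_ord /= add0n ltnNge (ltnW (ltn_ord i)) addr0.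
rewrite -big_mkcond /=; apply: eq_bigr => j _; rewrite lift_last_tperm.
by congr (a (tperm _ _) w); apply: val_inj => /=; rewrite /bump leqNgt ltn_ord.
Qed.

(** [stab f] is the disjoint union of cosets of its subgroup fixing the last point, represented by
    the transpositions of that point with the points of its level set. *)
Lemma symm_last f w : symm a f w =
  \sum_(j | f j == f ord_max)
    a (tperm j ord_max) (symm restrict (fun k => f (lift ord_max k)) w).
Proof.
rewrite /symm (partition_big (fun g : {perm 'I_n.+1} => (g^-1)%g ord_max)
  (fun j => f j == f ord_max)) => [|g gs] /=; last first.
  by rewrite (stabP _ _ (stabV gs)).
apply: eq_bigr => j /eqP fj; set t := tperm j ord_max.
have ts : t \in stab f by apply/stabP => k; rewrite /t; case: tpermP => // ->.
rewrite raddf_sum (reindex_inj (mulgI t)) /=.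
rewrite (eq_bigl (fun h => h \in (@lift_last n) @: stab (fun k => f (lift ord_max k)))).
  rewrite big_imset; last by move=> g h _ _; apply: lift_last_inj.
  by apply: eq_bigr => g _; rewrite gaM.
move=> h; apply/andP/imsetP => [[hs]|[g gs ->]].
  rewrite (canF_eq (permKV _)) permM tpermL => /eqP hm.
  have [g E] := fix_last_lift (esym hm); exists g => //; rewrite E in hs.
  apply/stabP => k; have := stabP _ _ (stabM ts hs) (lift ord_max k).
  by rewrite mulgA tperm2 mul1g lift_perm_lift.
split; last by rewrite (canF_eq (permKV _)) permM tpermL lift_perm_id.
apply: stabM => //; apply/stabP => k; case: (unliftP ord_max k) => [m ->|->].
  by rewrite lift_perm_lift (stabP _ _ gs m).
by rewrite lift_perm_id.
Qed.
End Restrict.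

(** The largest entry of the row-reading tableau ends the last row. Deleting its node, and the row
    with it if the row has length one, moves no other entry. *)
Lemma partition_removed n l : is_partition n.+1 l ->
  exists2 l', is_partition n l' & forall k, (k < n)%N -> rowcol l' k = rowcol l k.
Proof.
move=> Pl; have El := partition_sumn Pl.
case/lastP: l Pl El => [|l b] // Pl El.
have El' : (sumn l + b = n.+1)%N by rewrite -El -cats1 sumn_cat /= addn0.
have b0 : (0 < b)%N.
  by have := @partition_nth_gt0 _ _ (size l) Pl; rewrite size_rcons nth_rcons ltnn eqxx; apply.
case/and3P: Pl => sl al _.
have sl' : sorted geq l.
  by move: sl; rewrite -cats1 => /cat_sorted2[].
have al' : all (fun x => 0 < x)%N l by move: al; rewrite all_rcons => /andP[].
case: (eqVneq b 1%N) => [b1|b1].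
  exists l; first by apply/and3P; split => //; apply/eqP; lia.
  by move=> k kn; rewrite rowcol_rcons //; lia.
exists (rcons l b.-1) => [|k kn]; last by rewrite !rowcol_rcons //; lia.
apply/and3P; split; last by apply/eqP; rewrite -cats1 sumn_cat /= addn0; lia.
  case: l sl {sl' al al' El El'} => //= c l; rewrite !rcons_path => /andP[-> /=]; lia.
by rewrite all_rcons al' andbT; lia.
Qed.

(** Induction on [n]. The smaller symmetrizer acts on [v] by [K.+1], so by [symm_last] a symmetrizer
    differing from [row] only in the place of the last point [m] acts as [K.+1] times a sum of
    transpositions [tperm j m]. Moving [m] up to row [q] gives a larger shape, which kills [v];
    division by [K.+1] then evaluates the transpositions of [m] with row [q]. *)
Lemma symm_weight n (V : zmodType) (a : gaction n V) (N : V -> Prop) l v :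
  subgroup_pred N -> (forall g x, N x -> N (a g x)) ->
  (forall x k, N (x *+ k.+1) -> N x) ->
  is_partition n l -> (forall i, N (jm a i v - v *~ content l i)) ->
  exists K, N (symm a (rowf n l) v - v *+ K.+1).
Proof.
move=> sN; elim: n a l => [|n IH] a l stN satN Pl wt.
  exists #|stab (rowf 0 l)|.-1; rewrite prednK; last first.
    by apply/card_gt0P; exists 1%g; apply: stab1.
  rewrite /symm (eq_bigr (fun=> v)) => [|g _]; last first.
    by rewrite (_ : g = 1%g) ?ga1 //; apply/permP => -[].
  by rewrite sumr_const subrr; apply: sub0.
have [l' Pl' ll'] := partition_removed Pl.
have wt' i : N (jm (restrict a) i v - v *~ content l' i).
  by rewrite jm_restrict /content ll' //; have := wt (lift ord_max i); rewrite /content lift_max.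
have [K HK] := IH (restrict a) l' (fun g x => stN (lift_last g) x) satN Pl' wt'.
set row := rowf n.+1 l; pose m := @ord_max n.
have rowE k : row (lift m k) = rowf n l' k.
  by rewrite /row /rowf (lift_max k) ll'.
have resE f : (forall k, f (lift m k) = row (lift m k)) -> forall w,
    symm (restrict a) (fun k => f (lift m k)) w = symm (restrict a) (rowf n l') w.
  by move=> fE w; apply: symm_ker => i j; rewrite !fE !rowE.
have kill := symm_sdominates_weight sN stN satN Pl wt.
set S0 := symm (restrict a) (rowf n l') v in HK.
have symmE f : (forall k, f (lift m k) = row (lift m k)) ->
    N (symm a f v - (\sum_(j | f j == f m) a (tperm j m) v) *+ K.+1).
  move=> fE; rewrite symm_last -sumrMnl -sumrB; apply: (sub_sum sN) => j _.
  by rewrite resE // -raddfMn -raddfB; apply: stN.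
have swap q : (q < row m)%N -> N (v + \sum_(j | row j == q) a (tperm j m) v).
  move=> qr; pose f k := if k == m then q else row k.
  have fE k : f (lift m k) = row (lift m k).
    by rewrite /f eq_sym (negPf (neq_lift _ _)).
  have fl k : (f k <= row k)%N by rewrite /f; case: eqP => // ->; apply: ltnW.
  have Nf : N (symm a f v).
    rewrite -[v](ga1 a); apply: (symm_higher Pl kill) => [i|].
      rewrite -(card_row_ltn i Pl); apply: subset_leq_card; apply/subsetP => k; rewrite !inE.
      exact: leq_ltn_trans.
    exists (row m); rewrite -(card_row_ltn _ Pl); apply: proper_card; apply/properP; split.
      by apply/subsetP => k; rewrite !inE; apply: leq_ltn_trans.
    by exists m; rewrite inE ?ltnn // /f eqxx.
  apply: (satN _ K); have := subB sN Nf (symmE f fE); rewrite opprB addrC subrK.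
  congr (N (_ *+ _)); rewrite (bigD1 m) //= tperm1 ga1; congr (_ + _).
  apply: eq_bigl => j; rewrite /f eqxx; case: (eqVneq j m) => [->|_] /=.
    by rewrite andbF (gtn_eqF qr).
  by rewrite andbT.
have rows i : (i <= row m)%N ->
    N (v *+ i + \sum_(j | (row j < i)%N) a (tperm j m) v).
  elim: i => [|i IHi] ir; first by rewrite mulr0n big_pred0 ?addr0 //; apply: sub0.
  rewrite (bigID (fun j => row j == i)) /= mulrS addrACA.
  rewrite (eq_bigl (fun j => row j == i)); last first.
    by move=> j; rewrite ltnS andbC; case: eqP => // ->; rewrite leqnn.
  rewrite [X in _ + (_ + X)](eq_bigl (fun j => (row j < i)%N)); last first.
    by move=> j; rewrite ltnS ltn_neqAle andbC.
  by apply: (subD sN); [apply: swap|apply/IHi/ltnW].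
(* The last Jucys-Murphy element acts on [v] by column minus row. Removing the contribution of the
   rows above leaves [c] for the transpositions inside the row of [m]; the identity raises this to
   [c.+1]. *)
pose c := colf n.+1 l m.
exists (K.+1 * c.+1).-1; rewrite prednK // mulnC mulrnA.
apply: (subDr sN (subN sN (symmE row (fun=> erefl)))).
rewrite opprB addrC subrKA -mulrnBl; apply: (subMn sN).
have := subB sN (wt m) (rows _ (leqnn _)).
have -> : jm a m v = \sum_(j | (row j < row m)%N) a (tperm j m) v +
   \sum_(j | (row j == row m) && (j != m)) a (tperm j m) v.
  rewrite /jm (bigID (fun j => (row j < row m)%N)) /=; congr (_ + _); apply: eq_bigl => j.
    rewrite andb_idl // => lt; rewrite ltnNge; apply: contraL lt => mj.
    by rewrite -leqNgt; apply: rowf_le.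
  have jm' : (row j <= row m)%N by apply: rowf_le => //; rewrite -ltnS.
  rewrite -leqNgt eqn_leq jm' /= andbC; congr andb.
  by rewrite ltn_neqAle -ltnS ltn_ord andbT.
rewrite /content -/(rowf n.+1 l m) -/(colf n.+1 l m) -/row -/c mulrzBr -!pmulrn mulrS.
rewrite (bigD1 m (P := fun j => row j == row m)) //= tperm1 ga1.
set S1 := \sum_(j | (_ < _)%N) _; set S2 := \sum_(j | _ && _) _.
rewrite opprB [S1 + S2]addrC -(addrA S2) (addrA S1) [v *+ row m + S1]addrC.
rewrite -(addrA S2) [S1 + v *+ row m - _ - _]addrAC subrr add0r.
by congr N; rewrite opprD addrACA subrr add0r.
Qed.

(** * The group algebra as a ring *)

(** A separate name that copies the module structure of finite functions but not their pointwise
    product, so that [*] can be the convolution. *)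
Definition galg (p n : nat) := RS p n.
HB.instance Definition _ p n :=
  GRing.Lmodule.copy (galg p n) {ffun {perm 'I_n} -> (Zloc p)^o}.

Section GroupAlgebra.
Variables p n : nat.
Implicit Types (a b c : galg p n) (s t : {perm 'I_n}).

Fact gmulA : associative (gmul p n).
Proof.
move=> a b c; apply/ffunP => g; rewrite !ffunE.
under eq_bigr => h _ do rewrite ffunE mulr_sumr.
under [RHS]eq_bigr => h _ do rewrite ffunE mulr_suml.
rewrite [RHS]exchange_big; apply: eq_bigr => h _ /=.
rewrite [RHS](reindex_inj (mulgI h)); apply: eq_bigr => k _ /=.
by rewrite mulKg invMg -!mulgA mulrA.
Qed.

Fact gmul1 : left_id (gone p n) (gmul p n).
Proof.
move=> a; apply/ffunP => g; rewrite !ffunE (bigD1 1%g) //= ffunE eqxx mul1r invg1 mul1g.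
by rewrite big1 ?addr0 // => h /negPf nh; rewrite ffunE nh mul0r.
Qed.

Fact gmulr1 : right_id (gone p n) (gmul p n).
Proof.
move=> a; apply/ffunP => g; rewrite !ffunE (bigD1 g) //= ffunE mulVg eqxx mulr1.
rewrite big1 ?addr0 // => h nh; rewrite ffunE (_ : (h^-1 * g)%g == 1%g = false) ?mulr0 //.
by apply: contraNF nh => /eqP E; rewrite -[g](mulKVg h) E mulg1.
Qed.

Fact gmulDl : left_distributive (gmul p n) +%R.
Proof.
move=> a b c; apply/ffunP => g; rewrite !ffunE -big_split; apply: eq_bigr => h _ /=.
by rewrite ffunE mulrDl.
Qed.

Fact gmulDr : right_distributive (gmul p n) +%R.
Proof.
move=> a b c; apply/ffunP => g; rewrite !ffunE -big_split; apply: eq_bigr => h _ /=.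
by rewrite ffunE mulrDr.
Qed.

HB.instance Definition _ := GRing.Zmodule_isPzRing.Build (galg p n)
  gmulA gmul1 gmulr1 gmulDl gmulDr.

Definition ge s : galg p n := gelt p n s.

Lemma gmulE a b : gmul p n a b = a * b. Proof. by []. Qed.

Lemma gscaleAl (r : Zloc p) a b : r *: (a * b) = (r *: a) * b.
Proof.
apply/ffunP => g; rewrite !ffunE scaler_sumr; apply: eq_bigr => h _.
by rewrite ffunE [LHS]mulrA.
Qed.

Lemma gscaleAr (r : Zloc p) a b : r *: (a * b) = a * (r *: b).
Proof.
apply/ffunP => g; rewrite !ffunE scaler_sumr; apply: eq_bigr => h _.
by rewrite ffunE mulrCA.
Qed.

Lemma ge1 : ge 1%g = 1. Proof. by []. Qed.

Lemma geM s t : ge (s * t)%g = ge s * ge t.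
Proof.
apply/ffunP => g; rewrite !ffunE (bigD1 s) //= !ffunE eqxx mul1r.
rewrite big1 ?addr0 => [|h /negPf nh]; last by rewrite ffunE nh mul0r.
congr (_%:R); congr nat_of_bool; apply/eqP/eqP => [->|<-]; first by rewrite mulKg.
by rewrite mulKVg.
Qed.

Lemma geV s : ge s * ge s^-1%g = 1. Proof. by rewrite -geM mulgV. Qed.

Lemma galg_sum a : a = \sum_s a s *: ge s.
Proof.
apply/ffunP => g; rewrite sum_ffunE (bigD1 g) //= !ffunE eqxx [_ *: _]mulr1.
by rewrite big1 ?addr0 // => h nh; rewrite !ffunE eq_sym (negPf nh) [_ *: _]mulr0.
Qed.

Lemma trC a b : (a * b) 1%g = (b * a) 1%g.
Proof.
rewrite !ffunE (reindex_inj (@invg_inj _)); apply: eq_bigr => h _.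
by rewrite !mulg1 invgK mulrC.
Qed.

Lemma Zloc_mulf_eq0 (x y : Zloc p) : x * y = 0 -> x != 0 -> y = 0.
Proof.
move=> /(congr1 val); rewrite rmorphM rmorph0 => /eqP; rewrite mulf_eq0.
case/orP => /eqP E; last by move=> _; apply: val_inj; rewrite E rmorph0.
by case/eqP; apply: val_inj; rewrite E rmorph0.
Qed.

Lemma galg_scaler_inj (r : Zloc p) : r != 0 -> injective (fun a => r *: a).
Proof.
move=> r0 a b /eqP; rewrite -subr_eq0 -scalerBr => /eqP E; apply/eqP.
rewrite -subr_eq0; apply/eqP/ffunP => g; rewrite [RHS]ffunE.
by apply: Zloc_mulf_eq0 r0; have := congr1 (fun c : galg p n => c g) E; rewrite /= !ffunE.
Qed.

Lemma Zloc_natr_neq0 k : k.+1%:R != 0 :> Zloc p.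
Proof.
apply/eqP => /(congr1 val); rewrite rmorph_nat rmorph0 => /eqP.
by rewrite pnatr_eq0.
Qed.

Lemma galg_mulrn_inj k : injective (fun a => a *+ k.+1).
Proof.
move=> a b /= E; apply: (galg_scaler_inj (Zloc_natr_neq0 k)).
by rewrite !scaler_nat.
Qed.

Fact galg_act1 a : ge 1%g * a = a. Proof. by rewrite ge1 mul1r. Qed.
Fact galg_actM s t a : ge (s * t)%g * a = ge s * (ge t * a).
Proof. by rewrite geM mulrA. Qed.
Definition galg_act : gaction n (galg p n) :=
  GAction (fun s => mulrDr (ge s)) galg_act1 galg_actM.

Lemma row_stabE l : row_stab l n = stab (rowf n l).
Proof. by apply/setP => s; rewrite !inE. Qed.

Lemma symm_galg l a : symm galg_act (rowf n l) a = (xlam p n l : galg p n) * a.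
Proof. by rewrite /symm /xlam row_stabE mulr_suml. Qed.

Lemma jm_galg i a : jm galg_act i a = (JM p n i : galg p n) * a.
Proof. by rewrite /jm /JM mulr_suml. Qed.

End GroupAlgebra.

(** * Dominance of standard tableaux *)

Lemma partition_size n l : is_partition n l -> (size l <= n)%N.
Proof.
move=> Pl; rewrite -(partition_sumn Pl).
by case/and3P: Pl => _ + _; elim: l => //= b l IH /andP[b0 /IH]; lia.
Qed.

Lemma rowf_ltn n l (i : 'I_n) : is_partition n l -> (rowf n l i < n)%N.
Proof.
move=> Pl; apply: leq_trans (partition_size Pl).
rewrite ltnNge; apply/negP => le.
have := @rowcol_ltn l i; rewrite (partition_sumn Pl) ltn_ord => /(_ isT).
by rewrite nth_default.
Qed.

Lemma colf_ltn n l (i : 'I_n) : (colf n l i < n)%N.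
Proof. have := rowcol_pos l i; have := ltn_ord i; rewrite /colf; lia. Qed.

Lemma node_exists n l r c : is_partition n l -> (c < nth 0 l r)%N ->
  exists i : 'I_n, rowf n l i = r /\ colf n l i = c.
Proof.
move=> Pl cr; have lt := node_ltn cr; rewrite (partition_sumn Pl) in lt.
by exists (Ordinal lt); rewrite /rowf /colf /= rowcol_node.
Qed.

Lemma node_inj n l (i j : 'I_n) : rowf n l i = rowf n l j ->
  colf n l i = colf n l j -> i = j.
Proof.
rewrite /rowf /colf => E1 E2; apply/val_inj/(@rowcol_inj l).
by move: E1 E2; case: (rowcol _ _) => ? ?; case: (rowcol _ _) => ? ? /= -> ->.
Qed.

Lemma colf_lt_nth n l (i : 'I_n) : is_partition n l ->
  (colf n l i < nth 0 l (rowf n l i))%N.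
Proof. by move=> Pl; apply: rowcol_ltn; rewrite (partition_sumn Pl). Qed.

Section Standard.
Variables (n : nat) (l : seq nat) (d : {perm 'I_n}).
Hypothesis Pl : is_partition n l.
Hypothesis sd : is_standard l n d.
Let row := rowf n l.
Let col := colf n l.

Lemma standard_step i j :
  (row j == row i) && (col j == (col i).+1) || (row j == (row i).+1) && (col j == col i) ->
  (d i < d j)%N.
Proof. by move=> H; have /forallP/(_ i)/forallP/(_ j)/implyP := sd; apply. Qed.

Lemma standard_row i j : row i = row j -> (col i < col j)%N -> (d i < d j)%N.
Proof.
have [k le] := ubnP (col j); elim: k j le => // k IH j le E lt.
have [j' [rj' cj']] : exists j' : 'I_n, row j' = row j /\ col j' = (col j).-1.
  by apply: node_exists => //; have := colf_lt_nth j Pl; rewrite -/(col j) -/(row j); lia.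
have step : (d j' < d j)%N.
  by apply: standard_step; rewrite rj' cj' eqxx /= prednK ?eqxx //; lia.
case: (ltngtP (col i) (col j')) => H; last 2 first.
- by lia.
- by have -> : i = j' by apply: (node_inj (etrans E (esym rj')) H).
by apply: ltn_trans (IH j' _ _ H) step; lia.
Qed.

Lemma standard_col i j : col i = col j -> (row i < row j)%N -> (d i < d j)%N.
Proof.
have [k le] := ubnP (row j); elim: k j le => // k IH j le E lt.
have [j' [rj' cj']] : exists j' : 'I_n, row j' = (row j).-1 /\ col j' = col j.
  apply: node_exists => //; have := colf_lt_nth j Pl; rewrite -/(col j) -/(row j).
  by move=> H; apply: leq_trans H (partition_nth Pl _); lia.
have step : (d j' < d j)%N.
  by apply: standard_step; rewrite rj' cj' eqxx /= prednK ?eqxx ?orbT //; lia.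
case: (ltngtP (row i) (row j')) => H; last 2 first.
- by lia.
- by have -> : i = j' by apply: (node_inj H (etrans E (esym cj'))).
by apply: ltn_trans (IH j' _ _ H) step; lia.
Qed.

(** Rows increase, so the column of an entry counts the smaller entries of its row. Hence the row
    word determines a standard tableau. *)
Lemma standard_cnt (i : 'I_n) :
  cnt (fun k => row (d^-1 k)%g) i (row (d^-1 i)%g) = col (d^-1 i)%g.
Proof.
rewrite -[RHS](cnt_rowf _ Pl) /cnt -[LHS](card_preimset _ (@perm_inj _ d)).
congr #|pred_of_set _|; apply/setP => k; rewrite !inE permK -/(row _).
case: (eqVneq (row k)) => E; rewrite ?andbF ?andbT //.
set b := (d^-1 i)%g in E *; rewrite -[i](permKV d) -/b.
have kb : (k < b)%N = (col k < col b)%N.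
  rewrite (rowcol_pos l k) [X in (_ < X)%N](rowcol_pos l b) -/(rowf n l k) -/(rowf n l b).
  by move: E; rewrite /row => ->; rewrite ltn_add2l.
rewrite kb; case: (ltngtP (col k) (col b)) => H.
- by rewrite standard_row.
- by rewrite ltnNge ltnW // standard_row.
- by rewrite (@node_inj n l k b) // ltnn.
Qed.
End Standard.

(** For the row function of a standard tableau, this is a partial sum of the shape formed by the
    entries below [m]. Comparing all these counts is the dominance order on tableaux, and
    [prefix_stat] condenses it to one number. *)
Definition prefix_count n (f : 'I_n -> nat) m k :=
  #|[set i : 'I_n | (i < m)%N && (f i < k)%N]|.

Definition prefix_stat n (f : 'I_n -> nat) :=
  (\sum_(m < n.+1) \sum_(k < n.+1) prefix_count f m k)%N.

Definition tableau_row n l (d : {perm 'I_n}) (i : 'I_n) := rowf n l (d^-1 i)%g.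
Definition tableau_col n l (d : {perm 'I_n}) (i : 'I_n) := colf n l (d^-1 i)%g.

(** Count along each column of [d]. Values of [f] are distinct there, so at most [k] of them are
    below [k]. If an entry below [m] lies in row [k] or lower, the [k] entries at the top of its
    column are smaller and all count on the right; otherwise every entry below [m] of the column
    does. *)
Lemma prefix_count_le n l (d : {perm 'I_n}) (f : 'I_n -> nat) :
  is_partition n l -> is_standard l n d ->
  (forall i j, i != j -> f i = f j -> tableau_col l d i <> tableau_col l d j) ->
  forall m k, (prefix_count f m k <= prefix_count (tableau_row l d) m k)%N.
Proof.
move=> Pl sd H m k; rewrite /prefix_count.
pose cc i : 'I_n := Ordinal (colf_ltn l (d^-1 i)%g).
rewrite -sum1dep_card -[leqRHS]sum1dep_card (partition_big cc predT) //=.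
rewrite [leqRHS](partition_big cc predT) //=; apply: leq_sum => c _.
rewrite !sum1dep_card.
set A := [set i | _]; set B := [set i | _].
have [all_lt|] := boolP [forall i : 'I_n, (i < m)%N && (cc i == c) ==> (tableau_row l d i < k)%N].
  apply: subset_leq_card; apply/subsetP => i; rewrite !inE => /andP[/andP[im _] ic].
  by rewrite im ic (implyP (forallP all_lt i)) ?im.
case/forallPn => i0; rewrite negb_imply -leqNgt => /andP[/andP[i0m /eqP i0c] ki0].
apply: (@leq_trans k).
  rewrite cardE -(size_map f) -[leqRHS](size_iota 0 k); apply: uniq_leq_size.
    rewrite map_inj_in_uniq ?enum_uniq // => i j; rewrite !mem_enum !inE.
    move=> /andP[_ /eqP ic] /andP[_ /eqP jc] fij; apply/eqP/negPn/negP => ij.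
    by apply: (H i j ij fij); rewrite -[LHS]/(cc i : nat) ic -jc.
  by move=> x /mapP[i]; rewrite mem_enum inE => /andP[/andP[_ fk] _] ->; rewrite mem_iota.
rewrite [leqRHS]cardE -(size_map (tableau_row l d)) -[leqLHS](size_iota 0 k).
apply: uniq_leq_size; first exact: iota_uniq.
move=> k'; rewrite mem_iota add0n => /= k'k.
have [i [ri ci]] : exists i : 'I_n, rowf n l i = k' /\ colf n l i = colf n l (d^-1 i0)%g.
  apply: node_exists => //; apply: leq_trans (colf_lt_nth _ Pl) (partition_nth Pl _).
  by apply: ltnW; apply: leq_trans k'k ki0.
apply/mapP; exists (d i); last by rewrite /tableau_row permK.
rewrite mem_enum inE /tableau_row permK ri k'k andbT; apply/andP; split; last first.
  by apply/eqP/val_inj; rewrite -i0c /= permK.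
apply: ltn_trans i0m; suff : (d i < d (d^-1 i0)%g)%N by rewrite permKV.
by apply: (standard_col Pl sd) => //; rewrite ri; apply: leq_trans k'k ki0.
Qed.

Lemma prefix_stat_le n (f f' : 'I_n -> nat) :
  (forall m k, (prefix_count f m k <= prefix_count f' m k)%N) ->
  (prefix_stat f <= prefix_stat f')%N.
Proof. by move=> H; apply: leq_sum => m _; apply: leq_sum => k _. Qed.

Lemma prefix_stat_eq n (f f' : 'I_n -> nat) :
  (forall m k, (prefix_count f m k <= prefix_count f' m k)%N) ->
  (forall i, (f i < n)%N) -> (forall i, (f' i < n)%N) ->
  prefix_stat f = prefix_stat f' -> f =1 f'.
Proof.
move=> H fn fn' E.
have Emk (m k : 'I_n.+1) : prefix_count f m k = prefix_count f' m k.
  have I1 (m' : 'I_n.+1) (_ : true) := leqif_sum (fun (k' : 'I_n.+1) (_ : true) => leqif_eq (H m' k')).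
  have /= := leqif_sum I1.
  case=> _; rewrite -/(prefix_stat f) -/(prefix_stat f') E eqxx.
  by move=> /esym/forallP/(_ m)/= /forallP/(_ k) /eqP.
have cS (g : 'I_n -> nat) (i : 'I_n) k :
    prefix_count g i.+1 k = (prefix_count g i k + (g i < k))%N.
  rewrite /prefix_count (cardsD1 i) inE ltnSn /= addnC; congr (_ + _)%N.
  congr #|pred_of_set _|; apply/setP => j; rewrite !inE ltnS (leq_eqVlt j) -val_eqE /=.
  by case: ltngtP.
have lt_eq i (k : 'I_n.+1) : (f i < k)%N = (f' i < k)%N.
  have i1 : (i.+1 < n.+1)%N by rewrite ltnS.
  have i0 : (i < n.+1)%N by apply: ltnW.
  have := Emk (Ordinal i1) k; rewrite /= !cS (Emk (Ordinal i0) k) => /addnI.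
  by case: (f i < k)%N; case: (f' i < k)%N.
move=> i; apply/eqP; rewrite eqn_leq -[(f i <= _)%N]ltnS -[(f' i <= _)%N]ltnS; apply/andP; split.
  have k1 : ((f' i).+1 < n.+1)%N by rewrite ltnS.
  by have := lt_eq i (Ordinal k1) => /= ->; rewrite ltnSn.
have k1 : ((f i).+1 < n.+1)%N by rewrite ltnS.
by have := lt_eq i (Ordinal k1) => /= <-; rewrite ltnSn.
Qed.

Lemma standard_tableau_inj n mu l (t v : {perm 'I_n}) :
  is_partition n mu -> is_partition n l ->
  is_standard mu n t -> is_standard l n v ->
  tableau_row mu t =1 tableau_row l v -> mu = l /\ t = v.
Proof.
move=> Pm Pl st sv E.
have Eml : mu = l.
  apply: (partition_eq Pm Pl) => k; rewrite -(card_row_ltn k Pm) -(card_row_ltn k Pl).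
  rewrite -(card_perm_set t^-1%g (fun j => rowf n mu j < k)%N).
  rewrite -(card_perm_set v^-1%g (fun j => rowf n l j < k)%N).
  congr #|pred_of_set _|; apply/setP => j; rewrite !inE.
  by rewrite -/(tableau_row mu t j) -/(tableau_row l v j) E.
split=> //; subst mu.
apply: invg_inj; apply/permP => i; apply: (@node_inj n l); first exact: E.
rewrite -(standard_cnt Pl st i) -(standard_cnt Pl sv i) -/(tableau_row l t i).
rewrite E /cnt; congr #|pred_of_set _|; apply/setP => k; rewrite !inE.
by rewrite -/(tableau_row l t k) E.
Qed.

(** * The pairing with column antisymmetrizers *)

Section Pairing.
Variables p n : nat.
Local Notation A := (galg p n).
Local Notation e := (@ge p n).
Local Notation x := (fun l => xlam p n l : A).

Definition col_antisymm l : A :=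
  \sum_(s in stab (colf n l)) ((-1) ^+ s : Zloc p) *: e s.

Lemma col_antisymmE l s :
  col_antisymm l s = if s \in stab (colf n l) then (-1) ^+ s else 0.
Proof.
rewrite /col_antisymm sum_ffunE; case: ifP => sl.
  rewrite (bigD1 s) //= !ffunE eqxx [_ *: _]mulr1 big1 ?addr0 // => t /andP[_ ts].
  by rewrite !ffunE eq_sym (negPf ts) [_ *: _]mulr0.
rewrite big1 // => t ts; rewrite !ffunE; case: eqP => [st|_]; last by rewrite [_ *: _]mulr0.
by rewrite st ts in sl.
Qed.

Lemma xlamE l s : x l s = (s \in row_stab l n)%:R.
Proof.
rewrite /= /xlam sum_ffunE; case: (boolP (s \in _)) => sl.
  by rewrite (bigD1 s) //= ffunE eqxx big1 ?addr0 // => t /andP[_ ts]; rewrite ffunE eq_sym (negPf ts).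
rewrite big1 // => t ts; rewrite ffunE; case: eqP => // st.
by rewrite -st (negPf sl) in ts.
Qed.

Lemma tperm_stab (f : 'I_n -> nat) i j : f i = f j -> tperm i j \in stab f.
Proof. by move=> E; apply/stabP => k; case: tpermP => // ->. Qed.

Lemma xlam_tperml l i j : rowf n l i = rowf n l j -> e (tperm i j) * x l = x l.
Proof.
move=> E; have := symm_stabl (galg_act p n) 1 (tperm_stab E).
by rewrite symm_galg mulr1.
Qed.

Lemma stab_mulr (f : 'I_n -> nat) s t : t \in stab f -> ((s * t)%g \in stab f) = (s \in stab f).
Proof.
move=> tf; apply/idP/idP => [st|sf]; last exact: stabM.
by rewrite -(mulgK t s); apply: stabM => //; apply: stabV.
Qed.

Lemma stab_mull (f : 'I_n -> nat) s t : t \in stab f -> ((t * s)%g \in stab f) = (s \in stab f).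
Proof.
move=> tf; apply/idP/idP => [st|sf]; last exact: stabM.
by rewrite -(mulKg t s); apply: stabM => //; apply: stabV.
Qed.

Lemma xlam_tpermr l i j : rowf n l i = rowf n l j -> x l * e (tperm i j) = x l.
Proof.
move=> E; rewrite /= /xlam row_stabE mulr_suml (reindex_inj (mulIg (tperm i j))) /=.
apply: eq_big => [s|s _]; first by rewrite stab_mulr ?tperm_stab.
by rewrite -geM -mulgA tperm2 mulg1.
Qed.

Lemma col_tpermr l i j : i != j -> colf n l i = colf n l j ->
  col_antisymm l * e (tperm i j) = - col_antisymm l.
Proof.
move=> ij E; rewrite /col_antisymm mulr_suml (reindex_inj (mulIg (tperm i j))) -sumrN /=.
apply: eq_big => [s|s _]; first by rewrite stab_mulr ?tperm_stab.
rewrite -gscaleAl -geM -mulgA tperm2 mulg1 odd_permM odd_tperm ij addbT -scaleNr.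
by case: odd_perm; rewrite ?expr1 ?opprK.
Qed.

Lemma col_tperml l i j : i != j -> colf n l i = colf n l j ->
  e (tperm i j) * col_antisymm l = - col_antisymm l.
Proof.
move=> ij E; rewrite /col_antisymm mulr_sumr (reindex_inj (mulgI (tperm i j))) -sumrN /=.
apply: eq_big => [s|s _]; first by rewrite stab_mull ?tperm_stab.
rewrite -gscaleAr -geM mulgA tperm2 mul1g odd_permM odd_tperm ij addTb -scaleNr.
by case: odd_perm; rewrite ?expr1 ?opprK.
Qed.

Lemma eqN_eq0 (a : A) : a = - a -> a = 0.
Proof.
move=> E; apply: (@galg_mulrn_inj p n 1); rewrite /= mul0rn mulr2n {1}E.
exact: addNr.
Qed.

Lemma ge_tpermJ (w : {perm 'I_n}) i j : e (tperm i j) * e w = e w * e (tperm (w i) (w j)).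
Proof. by rewrite -!geM -tpermJ conjgE mulKVg -?mulgA. Qed.

(** The row symmetrizer absorbs [tperm i j], while the column antisymmetrizer changes sign under its
    conjugate by [w]. The product equals its opposite, and 2 is not a zero divisor even when it is
    not invertible. *)
Lemma row_col_eq0 mu l (w : {perm 'I_n}) i j : i != j -> rowf n mu i = rowf n mu j ->
  colf n l (w i) = colf n l (w j) -> x mu * e w * col_antisymm l = 0.
Proof.
move=> ij Er Ec; apply: eqN_eq0.
rewrite -{1}(xlam_tpermr Er) -(mulrA (x mu)) ge_tpermJ -!mulrA.
by rewrite col_tperml ?(inj_eq (@perm_inj _ _)) // !mulrN.
Qed.

Lemma col_row_eq0 mu l (w : {perm 'I_n}) i j : i != j -> colf n l i = colf n l j ->
  rowf n mu (w i) = rowf n mu (w j) -> col_antisymm l * e w * x mu = 0.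
Proof.
move=> ij Ec Er; apply: eqN_eq0.
rewrite -{1}(xlam_tperml Er) mulrA -(mulrA (col_antisymm l)) -ge_tpermJ mulrA.
by rewrite (col_tpermr ij Ec) !mulNr.
Qed.

Definition pairing l (u v : {perm 'I_n}) (a : A) : Zloc p :=
  (a * (e v^-1%g * col_antisymm l * e u)) 1%g.

Lemma pairingD l u v : {morph pairing l u v : a b / a + b}.
Proof. by move=> a b; rewrite /pairing mulrDl ffunE. Qed.

Lemma pairingZ l u v r a : pairing l u v (r *: a) = r * pairing l u v a.
Proof. by rewrite /pairing -gscaleAl ffunE. Qed.

Lemma pairing0 l u v : pairing l u v 0 = 0.
Proof. by rewrite /pairing mul0r ffunE. Qed.

Local Notation mur := (fun l s t => murphy p n l s t : A).

(** The trace property [trC] cancels the translations, leaving the coefficient of 1 in the row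
    symmetrizer times the column antisymmetrizer. The two stabilizers meet only in the identity. *)
Lemma pairing_diag l s t : pairing l s t (mur l s t) = 1.
Proof.
rewrite /pairing /= /murphy !gmulE -/(e _) -/(e t).
rewrite -!mulrA [X in _ * (_ * X)]mulrA geV mul1r trC -!mulrA geV mulr1.
rewrite ffunE (bigD1 1%g) //= xlamE col_antisymmE invg1 mulg1 row_stabE !stab1.
rewrite odd_perm1 expr0 mulr1 big1 ?addr0 // => g g1.
rewrite xlamE col_antisymmE row_stabE mulg1; case: (boolP (g \in _)) => gr; last by rewrite mul0r.
case: ifP => [gc|_]; last by rewrite mulr0.
case/eqP: g1; apply/permP => k; rewrite perm1; apply: (@node_inj n l).
  exact: (stabP _ _ gr).
by have := stabP _ _ (stabV gc) k; rewrite invgK.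
Qed.

(** Two entries in a common row of [t] and a common column of [v] annihilate the product by
    [row_col_eq0]. After a cyclic rotation under the trace, [col_row_eq0] treats [s] and [u]
    alike. *)
Lemma pairing_neq0 l u v mu s t : pairing l u v (mur mu s t) != 0 ->
  (forall i j, i != j -> tableau_row mu t i = tableau_row mu t j ->
     tableau_col l v i <> tableau_col l v j) /\
  (forall i j, i != j -> tableau_row mu s i = tableau_row mu s j ->
     tableau_col l u i <> tableau_col l u j).
Proof.
rewrite /pairing /= /murphy !gmulE -/(e _) -/(e t) => nz.
split=> i j ij Er Ec; case/eqP: nz.
  rewrite (_ : _ * _ = e s^-1%g * (x mu * e (t * v^-1)%g * col_antisymm l) * e u); last first.
    by rewrite geM !mulrA.
  rewrite (@row_col_eq0 mu l _ (t^-1 i)%g (t^-1 j)%g) ?mulr0 ?mul0r ?ffunE //.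
    by rewrite (inj_eq (@perm_inj _ _)).
  by rewrite !permM !permKV.
rewrite trC (_ : _ * _ = e v^-1%g * (col_antisymm l * e (u * s^-1)%g * x mu) * e t); last first.
  by rewrite geM !mulrA.
rewrite (@col_row_eq0 mu l _ (u^-1 i)%g (u^-1 j)%g) ?mulr0 ?mul0r ?ffunE //.
  by rewrite (inj_eq (@perm_inj _ _)).
by rewrite !permM !permKV.
Qed.
End Pairing.

(** * The cell module *)

Section Murphy.
Variables p n : nat.
Local Notation A := (galg p n).
Local Notation e := (@ge p n).
Local Notation x := (fun l => xlam p n l : A).
Local Notation key := (seq nat * ({perm 'I_n} * {perm 'I_n}))%type.

Definition murphy_key (k : key) : A := murphy p n k.1 k.2.1 k.2.2.

Lemma murphy_keyE k : murphy_key k = e k.2.1^-1%g * x k.1 * e k.2.2.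
Proof. by []. Qed.

Definition key_valid (k : key) :=
  [&& is_partition n k.1, is_standard k.1 n k.2.1 & is_standard k.1 n k.2.2].

Definition key_stat (k : key) : nat :=
  prefix_stat (tableau_row k.1 k.2.1) + prefix_stat (tableau_row k.1 k.2.2).

(** A nonzero pairing makes both tableaux of [k] dominate those of [k'], by [prefix_count_le]. Equal
    statistics force equal row words, hence equal tableaux and shapes. *)
Lemma pairing_unitriangular k k' : key_valid k -> key_valid k' ->
  pairing k.1 k.2.1 k.2.2 (murphy_key k') != 0 ->
  k' = k \/ (key_stat k' < key_stat k)%N.
Proof.
case: k k' => [l [u v]] [mu [s t]] /and3P[/= Pl su sv] /and3P[/= Pm ss st].
move=> /pairing_neq0[Ht Hs].
have Ct := prefix_count_le Pl sv Ht; have Cs := prefix_count_le Pl su Hs.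
have := prefix_stat_le Ct; have := prefix_stat_le Cs; rewrite /key_stat /=.
rewrite leq_eqVlt => /orP[/eqP Es|lts]; last by right; rewrite -addSn leq_add.
rewrite leq_eqVlt => /orP[/eqP Et|ltt]; last by right; rewrite Es ltn_add2l.
left; have ltr l' (d : {perm 'I_n}) i : is_partition n l' -> (tableau_row l' d i < n)%N.
  by move=> Pl'; apply: rowf_ltn.
have [Eml <-] := standard_tableau_inj Pm Pl st sv
  (prefix_stat_eq Ct (fun i => ltr _ _ i Pm) (fun i => ltr _ _ i Pl) Et).
have [_ <-] := standard_tableau_inj Pm Pl ss su
  (prefix_stat_eq Cs (fun i => ltr _ _ i Pm) (fun i => ltr _ _ i Pl) Es).
by rewrite Eml.
Qed.

Variable l : seq nat.
Hypothesis Pl : is_partition n l.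
Local Notation N := (RSdom p n l : A -> Prop).

Definition key_above (k : key) := key_valid k && sdominates k.1 l.

Lemma RSdomP (y : A) : N y <->
  exists c : seq (Zloc p * key), all (fun z => key_above z.2) c /\
    y = \sum_(z <- c) z.1 *: murphy_key z.2.
Proof.
split=> -[c [vc ->]]; exists c; split=> //; apply: sub_all vc => z.
  by rewrite /key_above /key_valid => /and4P[-> -> -> ->].
by rewrite /key_above /key_valid => /andP[/and3P[-> -> ->] ->].
Qed.

Lemma RSdomZ r (y : A) : N y -> N (r *: y).
Proof.
move=> /RSdomP[c [vc ->]]; apply/RSdomP; exists [seq (r * z.1, z.2) | z <- c].
by rewrite all_map; split=> //; rewrite big_map scaler_sumr; apply: eq_bigr => z _ /=; rewrite scalerA.
Qed.

Lemma RSdom_subgroup : subgroup_pred N.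
Proof.
split; first by apply/RSdomP; exists [::]; rewrite big_nil.
move=> y z Ny /(RSdomZ (-1)); rewrite scaleN1r; move: Ny.
move=> /RSdomP[c [vc ->]] /RSdomP[d [vd ->]]; apply/RSdomP; exists (c ++ d).
by rewrite all_cat vc vd big_cat.
Qed.

Lemma RSdom_murphy k : key_above k -> N (murphy_key k).
Proof.
by move=> vk; apply/RSdomP; exists [:: (1, k)]; rewrite /= vk big_seq1 scale1r.
Qed.

(** A combination may list a key several times; its coefficients are collected so that the pairing
    can isolate them. *)
Lemma big_keys (c : seq (Zloc p * key)) (F : key -> A) :
  \sum_(z <- c) z.1 *: F z.2 =
  \sum_(k <- undup (map snd c)) (\sum_(z <- c | z.2 == k) z.1) *: F k.
Proof.
under [RHS]eq_bigr => k _ do rewrite scaler_suml.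
rewrite (exchange_big_dep xpredT) //=; rewrite big_seq [RHS]big_seq.
apply: eq_bigr => z zc.
rewrite -big_filter (@eq_filter _ _ (pred1 z.2)) => [|k]; last by rewrite /= eq_sym.
rewrite filter_pred1_uniq ?undup_uniq ?mem_undup ?map_f //.
by rewrite big_seq1.
Qed.

(** Pair [r *: y] with [k]: the diagonal term is [C k], and the other terms vanish or come from keys
    of smaller [key_stat], whose coefficients are multiples of [r] by induction. So [r] divides
    every coefficient and cancels. *)
Lemma RSdom_saturated r (y : A) : r != 0 -> N (r *: y) -> N y.
Proof.
move=> r0 /RSdomP[c [vc E]]; rewrite big_keys in E.
set K := undup _ in E; pose C k := \sum_(z <- c | z.2 == k) z.1.
have vK k : k \in K -> key_above k.
  by rewrite mem_undup => /mapP[z zc ->]; apply: (allP vc).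
have vK' k : k \in K -> key_valid k by move/vK => /andP[].
have divC k : k \in K -> exists b, C k = r * b.
  have [m le] := ubnP (key_stat k); elim: m k le => // m IH k le kK.
  pose phi := pairing (p := p) k.1 k.2.1 k.2.2.
  have := congr1 phi E; rewrite /phi pairingZ.
  rewrite (big_morph _ (@pairingD p n _ _ _) (@pairing0 p n _ _ _)).
  rewrite (bigD1_seq k) ?undup_uniq //= pairingZ pairing_diag mulr1 -/(C k).
  set S := \sum_(_ <- _ | _) _.
  have [b ->] : exists b, S = r * b.
    rewrite /S big_seq_cond; apply: (big_ind (fun s => exists b, s = r * b)).
    - by exists 0; rewrite mulr0.
    - by move=> s1 s2 [b1 ->] [b2 ->]; exists (b1 + b2); rewrite mulrDr.
    move=> k' /andP[k'K nk]; rewrite pairingZ -/(C k').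
    have [->|nz] := eqVneq (pairing k.1 k.2.1 k.2.2 (murphy_key k')) 0.
      by exists 0; rewrite !mulr0.
    have [E'|lt] := pairing_unitriangular (vK' _ kK) (vK' _ k'K) nz.
      by rewrite E' eqxx in nk.
    have [b ->] := IH k' (leq_trans lt le) k'K.
    by exists (b * pairing k.1 k.2.1 k.2.2 (murphy_key k')); rewrite mulrA.
  by move/eqP; rewrite -subr_eq -mulrBr => /eqP <-; eexists.
have [z Nz Ez] : exists2 z, N z & \sum_(k <- K) C k *: murphy_key k = r *: z.
  elim: (K) vK divC => [_ _|k K' IH vK1 divC1].
    by exists 0; [exact: (sub0 RSdom_subgroup)|rewrite big_nil scaler0].
  have [||z Nz Ez] := IH.
  - by move=> k' k'K; apply: vK1; rewrite inE k'K orbT.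
  - by move=> k' k'K; apply: divC1; rewrite inE k'K orbT.
  have [b Eb] := divC1 k (mem_head _ _).
  exists (b *: murphy_key k + z).
    by apply: (subD RSdom_subgroup) => //; apply/RSdomZ/RSdom_murphy/vK1/mem_head.
  by rewrite big_cons Ez Eb scalerDr scalerA.
by rewrite (galg_scaler_inj r0 (etrans E Ez)).
Qed.

(** The anti-involution inverting group elements. It fixes the row symmetrizers and exchanges left
    and right translates, so one straightening lemma serves both sides. *)
Definition gstar (a : A) : A := [ffun s => a s^-1%g].

Lemma gstarB : {morph gstar : a b / a - b}.
Proof. by move=> a b; apply/ffunP => s; rewrite !ffunE. Qed.

Lemma gstarM a b : gstar (a * b) = gstar b * gstar a.
Proof.
apply/ffunP => g; rewrite !ffunE (reindex_inj (mulgI g^-1%g)).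
apply: eq_bigr => h _; rewrite !ffunE mulrC /=; congr (b _ * a _).
  by rewrite invMg invgK mulgK.
by rewrite invMg invgK.
Qed.

Lemma gstar_ge s : gstar (e s) = e s^-1%g.
Proof. by apply/ffunP => g; rewrite !ffunE (canF_eq (@invgK _)). Qed.

Lemma gstar_xlam mu : gstar (x mu) = x mu.
Proof.
apply/ffunP => g; rewrite !ffunE !xlamE row_stabE; congr (nat_of_bool _)%:R.
by apply/idP/idP => /stabV; rewrite ?invgK.
Qed.

(** Induction from the top of the dominance order disposes of the larger shapes met in
    straightening. One side is treated at a time: first the left factor with a standard right one,
    then the right factor through [gstar]. *)
Lemma RSdom_perm_ideal mu : is_partition n mu -> sdominates mu l ->
  forall g h, N (e g * x mu * e h).
Proof.
move=> Pm; elim/(@sdominates_ind n): Pm => {}mu Pm IH D.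
have IH' nu g h : is_partition n nu -> sdominates nu mu -> N (e g * x nu * e h).
  by move=> Pn Dn; apply: IH => //; apply: (sdominates_trans Pn Pm Pl Dn D).
have sN := RSdom_subgroup.
have left_std g t : is_standard mu n t -> N (e g * x mu * e t).
  move=> st; suff : (fun z => N (z * e t)) (galg_act p n g (symm (galg_act p n) (rowf n mu) 1)).
    by rewrite symm_galg mulr1.
  apply: (@straighten n A (galg_act p n) (fun z => N (z * e t)) _ mu 1 Pm).
  - split=> [|y z Ny Nz]; first by rewrite mul0r; apply: (sub0 sN).
    by rewrite mulrBl; apply: (subB sN).
  - move=> nu Pn Dn g' h; rewrite symm_galg /= mulr1 mulrA -mulrA -geM.
    exact: IH'.
  move=> d sd; rewrite symm_galg /= mulr1.
  by apply: (@RSdom_murphy (mu, (d, t))); apply/andP; split=> //; apply/and3P.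
move=> g h; suff : (fun z => N (e g * gstar z))
    (galg_act p n h^-1%g (symm (galg_act p n) (rowf n mu) 1)).
  by rewrite symm_galg mulr1 /= gstarM gstar_ge gstar_xlam invgK mulrA.
apply: (@straighten n A (galg_act p n) (fun z => N (e g * gstar z)) _ mu 1 Pm).
- split=> [|y z Ny Nz]; last by rewrite gstarB mulrBr; apply: (subB sN).
  by rewrite (_ : gstar 0 = 0) ?mulr0; [apply: (sub0 sN)|apply/ffunP => s; rewrite !ffunE].
- move=> nu Pn Dn g' h'; rewrite symm_galg /= mulr1 !gstarM !gstar_ge gstar_xlam.
  by rewrite !mulrA -geM; apply: IH'.
move=> d sd; rewrite symm_galg /= mulr1 gstarM gstar_ge gstar_xlam invgK mulrA.
exact: left_std.
Qed.

Lemma RSdom_left_ideal (a y : A) : N y -> N (a * y).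
Proof.
move=> /RSdomP[c [vc ->]]; rewrite mulr_sumr big_seq; apply: (sub_sum RSdom_subgroup) => z zc.
have /andP[/and3P[Pm _ _] D] := allP vc z zc.
rewrite -gscaleAr; apply: RSdomZ; rewrite [a]galg_sum mulr_suml.
apply: (sub_sum RSdom_subgroup) => s _; rewrite -gscaleAl; apply: RSdomZ.
by rewrite murphy_keyE !mulrA -geM; apply: RSdom_perm_ideal.
Qed.

Lemma JM_xlam i : N ((JM p n i - (content l i)%:~R *: gone p n : A) * x l).
Proof.
suff : N (jm (galg_act p n) i (symm (galg_act p n) (rowf n l) 1) -
          symm (galg_act p n) (rowf n l) 1 *~ content l i).
  by rewrite symm_galg jm_galg mulr1 mulrBl -gscaleAl mul1r scaler_int.
apply: (jm_symm RSdom_subgroup Pl).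
by move=> nu Pn D g h; rewrite symm_galg /= mulr1 mulrA; apply: RSdom_perm_ideal.
Qed.

(** Saturation removes the scalar [r]. As [N] is a left ideal, only the generators remain, and these
    are settled by [JM_xlam]. *)
Lemma Ind_ker_RSdom (y : A) : Ind_ker p n l y -> N (y * x l).
Proof.
case=> r r0 [c [cI E]]; apply: (RSdom_saturated r0).
rewrite gscaleAl (E : r *: y = \sum_(z <- c) (z.1 : A) * z.2) mulr_suml big_seq.
apply: (sub_sum RSdom_subgroup) => z zc; rewrite -mulrA; apply: RSdom_left_ideal.
have [gs [_ ->]] := cI z zc.
rewrite [X in N (X * _)](_ : _ = \sum_(i < n) (gs i : A) * (JM p n i - (content l i)%:~R *: gone p n : A)) //.
rewrite mulr_suml; apply: (sub_sum RSdom_subgroup) => i _.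
by rewrite -mulrA; apply: RSdom_left_ideal; apply: JM_xlam.
Qed.

(** * The kernel of the projection onto the induced module, and injectivity *)

Local Notation K := (in_RSIlam p n l : A -> Prop).

Lemma RSIlamD (y z : A) : K y -> K z -> K (y + z).
Proof.
move=> [c [cI ->]] [d [dI ->]]; exists (c ++ d); split; last by rewrite big_cat.
by move=> w; rewrite mem_cat => /orP[/cI|/dI].
Qed.

Lemma RSIlamM (a y : A) : K y -> K (a * y).
Proof.
move=> [c [cI ->]]; exists [seq (a * z.1 : RS p n, z.2) | z <- c]; split.
  move=> _ /mapP[z zc ->]; exact: cI zc.
rewrite big_map; rewrite [LHS](@mulr_sumr A); apply: eq_bigr => z _.
exact: (@mulrA A).
Qed.

Lemma RSIlamZ r (y : A) : K y -> K (r *: y).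
Proof. by move=> Ky; rewrite -[y]mul1r gscaleAl; apply: RSIlamM. Qed.

Local Notation I := (Ind_ker p n l : A -> Prop).

Lemma Zloc_mulf_neq0 (r s : Zloc p) : r != 0 -> s != 0 -> r * s != 0.
Proof. by move=> r0; apply: contra_neq => /Zloc_mulf_eq0; apply. Qed.

Lemma Ind_ker_subgroup : subgroup_pred I.
Proof.
split.
  exists 1; first exact: (Zloc_natr_neq0 p 0).
  by exists [::]; split=> [z|]; rewrite ?in_nil // big_nil scaler0.
move=> y z [r r0 Ky] [s s0 Kz]; exists (r * s); first exact: Zloc_mulf_neq0.
have -> : (r * s) *: (y - z : RS p n) = s *: (r *: y) + (- r) *: (s *: z).
  by rewrite !scalerA scalerBr mulNr scaleNr [s * r]mulrC.
by apply: RSIlamD; apply: RSIlamZ.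
Qed.

Lemma Ind_ker_left_ideal (a y : A) : I y -> I (a * y).
Proof. by case=> r r0 Ky; exists r => //; rewrite (gscaleAr r a y); apply: RSIlamM. Qed.

Lemma Ind_ker_saturated (y : A) k : I (y *+ k.+1) -> I y.
Proof.
case=> r r0 Ky; exists (r * k.+1%:R); first exact/Zloc_mulf_neq0/Zloc_natr_neq0.
by rewrite -scalerA scaler_nat.
Qed.

Lemma JM_Ind_ker (i : 'I_n) :
  I (jm (galg_act p n) i 1 - 1 *~ content l i).
Proof.
rewrite jm_galg mulr1; exists 1; first exact: (Zloc_natr_neq0 p 0).
rewrite scale1r; exists [:: (gone p n, JM p n i - (content l i)%:~R *: gone p n)]; split.
  move=> z; rewrite inE => /eqP -> /=.
  exists (fun j => if j == i then gone p n else 0); split.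
    move=> j; case: eqP => _.
      by exists [:: (1, [::])]; rewrite big_seq1 scale1r.
    by exists [::]; rewrite big_nil.
  rewrite (bigD1 i) //= eqxx big1 => [|j /negPf ->]; last exact: (@mul0r A).
  rewrite addr0; symmetry; exact: (@mul1r A).
rewrite big_seq1 /=; symmetry; rewrite [LHS](@mul1r A).
by congr (_ - _); rewrite scaler_int.
Qed.

(** The class of 1 has weight [l], so larger shapes kill it and [y * x l] lies in [I]. By
    [symm_weight], [x l] acts on that class by a positive integer; hence a positive multiple of [y]
    lies in the saturated [I]. *)
Lemma RSdom_Ind_ker (y : A) : N (y * x l) -> I y.
Proof.
move=> Ny; have sI := Ind_ker_subgroup.
have stI g z : I z -> I (galg_act p n g z) by move=> Iz; apply: Ind_ker_left_ideal.
have Iyx : I (y * x l).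
  move: Ny => /RSdomP[c [vc ->]]; rewrite big_seq; apply: (sub_sum sI) => z zc.
  have /andP[/and3P[Pm _ _] D] := allP vc z zc.
  rewrite -[murphy_key _]mul1r gscaleAl; apply: Ind_ker_left_ideal.
  have := symm_sdominates_weight sI stI Ind_ker_saturated Pl JM_Ind_ker Pm D.
  by move=> /(_ z.2.2.1^-1%g z.2.2.2); rewrite symm_galg /= mulr1 mulrA murphy_keyE.
have [k Ik] := symm_weight sI stI Ind_ker_saturated Pl JM_Ind_ker.
apply: (@Ind_ker_saturated _ k).
have := subB sI Iyx (Ind_ker_left_ideal y Ik).
by rewrite symm_galg mulr1 mulrBr opprB addrC subrK mulrnAr mulr1.
Qed.

End Murphy.

(* For every partition lambda of n, Ind(lambda) ~= C(lambda) as left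
   R S_n-modules, where R = Z_(p), p prime. *)
Theorem mainTheorem10 (p n : nat) (l : seq nat) :
  prime p -> is_partition n l ->
  quot_iso p n (fun _ : RS p n => True) (Ind_ker p n l)
           (cell_num p n l) (RSdom p n l).
Proof.
move=> _ Pl; have [N0 _] := RSdom_subgroup p n l.
exists (fun y => gmul p n y (xlam p n l)); split.
- by move=> y _; exists y, 0; rewrite addr0.
- by move=> y; apply: Ind_ker_RSdom.
- move=> a y z _ _; rewrite -[X in RSdom _ _ _ X](_ : 0 = _) //.
  by apply/esym/eqP; rewrite subr_eq0 (gmulDl (gmul p n a y) z) (gmulA a y).
- by move=> y _; apply: RSdom_Ind_ker.
move=> _ [a [b [Nb ->]]]; exists a => //.
by rewrite opprD addrA subrr sub0r; apply: (subN (RSdom_subgroup p n l)).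
Qed.
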